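(* Let $G$ be a fixed directed graph (its size a constant independent of $n$). There is a succinct data structure which, given any length-$n$ walk $(v_0,\ldots,v_n)$ on $G$, stores it using $\lg_2|G|+\sum_{i=0}^{n-1}\lg_2(\deg(v_i))+O(1)$ bits of space and retrieves any vertex $v_q$, $q\in\{0,\ldots,n\}$, in $O(\lg n)$ time on a word RAM with word size $\Theta(\lg n)$, assuming a precomputed lookup table of size $\tilde{O}(n^6)$ that does not depend on the walk.
   Context: A length-$n$ walk on $G$ is a sequence $(v_0,\ldots,v_n)$ of vertices with a directed edge from $v_i$ to $v_{i+1}$ for each $i$; $\deg(v)$ denotes the out-degree of $v$ in $G$ and $|G|$ the number of vertices. The lookup table contains only precomputed information depending on $G$ and $n$ and is not counted in the stated space. $\tilde{O}$ hides polylogarithmic factors. *)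

(* Defs.v *)
From mathcomp Require Import all_boot all_order all_algebra.
From mathcomp Require Import reals exp.

Set Implicit Arguments.
Unset Strict Implicit.
Unset Printing Implicit Defensive.

(** * Graphs and logarithms *)

(* A directed graph is a relation [e] on a finite type of vertices (loops are
   allowed).  A length-n walk is an (n+1)-tuple [v] with [sorted e v], i.e.
   [e] holds between any two consecutive entries. *)
Definition outdeg (V : finType) (e : rel V) (x : V) : nat :=
  #|[set y | e x y]|.

Definition log2 (R : realType) (x : R) : R := (ln x / ln 2)%R.

(* floor (lg n) + 1: this is Theta(lg n) for n >= 2, and it is still positive
   at n = 1, so that O(lg n) bounds make sense there. *)
Definition bitlen (n : nat) : nat := (trunc_log 2 n).+1.

(** * The word RAM *)

Inductive binop :=
  | OpAdd | OpSub | OpMul | OpDiv | OpMod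
  | OpAnd | OpOr | OpXor | OpShl | OpShr.

(* Register names, immediate constants and jump targets are part of the
   program text; memory is addressed indirectly, through register contents. *)
Inductive instr :=
  | IConst of nat & nat                (* rd := constant *)
  | IMove of nat & nat                 (* rd := rs *)
  | IBinop of binop & nat & nat & nat  (* rd := rs op rt *)
  | ILoad of nat & nat                 (* rd := memory[ra] *)
  | IStore of nat & nat                (* memory[ra] := rs *)
  | IJump of nat
  | IJumpLt of nat & nat & nat         (* if rs < rt goto target *)
  | IJumpEq of nat & nat & nat         (* if rs = rt goto target *)
  | IHalt.

Definition program := seq instr.

(* Every register and every memory cell contains a number below 2 ^ w; in
   particular only the addresses below 2 ^ w can be accessed. *)
Record state := State {
  pc : nat;
  reg : nat -> nat;
  memory : nat -> nat
}.

Definition upd (f : nat -> nat) (a x : nat) : nat -> nat :=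
  fun b => if b == a then x else f b.

(* Arithmetic is modulo 2 ^ w; x / 0 = 0 and x mod 0 = x. *)
Definition eval_binop (w : nat) (op : binop) (x y : nat) : nat :=
  match op with
  | OpAdd => (x + y) %% 2 ^ w
  | OpSub => (x + 2 ^ w - y) %% 2 ^ w
  | OpMul => (x * y) %% 2 ^ w
  | OpDiv => x %/ y
  | OpMod => x %% y
  | OpAnd => Nat.land x y
  | OpOr => Nat.lor x y
  | OpXor => Nat.lxor x y
  | OpShl => (x * 2 ^ y) %% 2 ^ w
  | OpShr => x %/ 2 ^ y
  end.

(* Running past the end of the program halts. *)
Definition fetch (P : program) (s : state) : instr := nth IHalt P (pc s).

Definition step (w : nat) (P : program) (s : state) : state :=
  let: State p r m := s in
  match fetch P s with
  | IConst d c => State p.+1 (upd r d (c %% 2 ^ w)) m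
  | IMove d a => State p.+1 (upd r d (r a)) m
  | IBinop op d a b => State p.+1 (upd r d (eval_binop w op (r a) (r b))) m
  | ILoad d a => State p.+1 (upd r d (m (r a))) m
  | IStore a b => State p.+1 r (upd m (r a) (r b))
  | IJump l => State l r m
  | IJumpLt a b l => State (if r a < r b then l else p.+1) r m
  | IJumpEq a b l => State (if r a == r b then l else p.+1) r m
  | IHalt => s
  end.

Definition halted (P : program) (s : state) : bool :=
  if fetch P s is IHalt then true else false.

(* The i-th w-bit word of a bit string, least significant bit first; beyond
   its end the string is padded with zeros. *)
Definition packed_word (w : nat) (s : bitseq) (i : nat) : nat :=
  \sum_(j < w) nth false s (i * w + j) * 2 ^ j.

(* The lookup table occupies the addresses from 0, and is followed by the bit
   string; all the remaining memory is zero.  The machine is not told the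
   length of either. *)
Definition init_mem (w : nat) (T : seq nat) (s : bitseq) (a : nat) : nat :=
  if a < size T then nth 0 T a else packed_word w s (a - size T).

(* The query is passed in register 0, all the other registers being zero. *)
Definition init_state (w : nat) (T : seq nat) (s : bitseq) (q : nat) : state :=
  State 0 (fun r => if r == 0 then q %% 2 ^ w else 0) (init_mem w T s).

(* A halted state is a fixed point of [step], so this says that the program
   halts after at most [t] instructions, with the answer in register 0. *)
Definition answers (w : nat) (P : program) (T : seq nat) (s : bitseq)
    (t q out : nat) : Prop :=
  let final := iter t (step w P) (init_state w T s q) in
  halted P final /\ reg final 0 = out.

(** * Succinct representations of walks *)

(* [enc] represents the length-n walks on [e], with [extra] bits of
   redundancy, so that the program [P], given the table [T], retrieves any
   vertex in [time] instructions.  The table and the program do not depend on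
   the walk.  A vertex is output as its index in the enumeration of [V]. *)
Definition stores_walks (R : realType) (V : finType) (e : rel V) (n w : nat)
    (P : program) (T : seq nat) (enc : n.+1.-tuple V -> bitseq)
    (extra time : nat) : Prop :=
  forall v : n.+1.-tuple V, sorted e v ->
    ((size (enc v))%:R <= log2 (#|V|%:R : R)
       + \sum_(i < n)
           log2 ((outdeg e (tnth v (widen_ord (leqnSn n) i)))%:R : R)
       + extra%:R)%R
    /\ forall q : 'I_n.+1,
         answers w P T (enc v) time q (enum_rank (tnth v q)).

(* Main.v *)
Require Import Defs.
From mathcomp Require Import all_boot all_order all_algebra.
From mathcomp Require Import reals sequences exp.
From mathcomp Require Import zify ring lra.

(* The vertices of a walk are the leaves of a balanced binary tree, and every
   node is labelled by the first and last vertex of its segment and by its cost,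
   the sum of [lg deg], rounded to multiples of [1 / n.+1], over all vertices of
   the segment but the last.  A segment is represented by memory bits and by a
   spill, a number in a small universe; the sizes of both depend on the label
   only.  The spills of the two children and the choice of their labels are
   merged into one number, whose low bits go to memory while the rest is the
   spill of the parent, as in Patrascu's Succincter.  A spill universe of size
   about n^3 absorbs the O(n^2) choices of the children's labels with a relative
   loss of O(1/n) per node, hence O(1) bits in total.  With [b ^ n.+1 = 1/2],
   weighting cost [l] by [b ^ l] turns out-degrees into transition
   probabilities, so that the weights of all root states sum to O(1); Kraft's
   inequality then gives a prefix code for the label and spill of the root under
   which every walk [v] takes [sum lg deg (v_i) + O(1)] bits.  The table lists
   the node states, and a query descends the tree, one record per level. *)

Set Implicit Arguments.
Unset Strict Implicit.
Unset Printing Implicit Defensive.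

Import Order.TTheory GRing.Theory Num.Theory.

(** * Arithmetic of bit strings *)

Lemma modn_exp2_split x a b :
  x %% 2 ^ (a + b) = x %% 2 ^ a + 2 ^ a * (x %/ 2 ^ a %% 2 ^ b).
Proof.
have P0 k : 0 < 2 ^ k by rewrite expn_gt0.
have lt1 : x %% 2 ^ a + 2 ^ a * (x %/ 2 ^ a %% 2 ^ b) < 2 ^ (a + b).
  rewrite expnD.
  have := ltn_pmod x (P0 a); have := ltn_pmod (x %/ 2 ^ a) (P0 b).
  move: (_ %% 2 ^ a) (_ %% 2 ^ b) => u v; nia.
rewrite {1}(divn_eq x (2 ^ a)) {1}(divn_eq (x %/ 2 ^ a) (2 ^ b)).
rewrite mulnDl -mulnA -expnD [b + a]addnC -addnA modnMDl.
by rewrite [_ * 2 ^ a]mulnC addnC modn_small.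
Qed.

Lemma divn_exp2 x a b : x %/ 2 ^ (a + b) = x %/ 2 ^ a %/ 2 ^ b.
Proof. by rewrite expnD divnMA. Qed.

Lemma modn_exp2_le x a b : a <= b -> x %% 2 ^ b %% 2 ^ a = x %% 2 ^ a.
Proof. by move=> ab; rewrite modn_dvdm // dvdn_exp2l. Qed.

Lemma divn_modn_exp2 x a b :
  (x %% 2 ^ (a + b)) %/ 2 ^ a = x %/ 2 ^ a %% 2 ^ b.
Proof.
rewrite modn_exp2_split addnC mulnC divnMDl ?expn_gt0 //.
by rewrite [x %% _ %/ _]divn_small ?addn0 // ltn_pmod ?expn_gt0.
Qed.

Lemma sum_binary_digits x w :
  \sum_(j < w) odd (x %/ 2 ^ j) * 2 ^ j = x %% 2 ^ w.
Proof.
elim: w => [|w IH]; first by rewrite big_ord0 expn0 modn1.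
by rewrite big_ord_recr /= IH -[w.+1]addn1 modn_exp2_split expn1 modn2 mulnC.
Qed.

Definition bits_of (L x : nat) : bitseq := mkseq (fun j => odd (x %/ 2 ^ j)) L.

Lemma packed_bits_of w L x i :
  x < 2 ^ L -> packed_word w (bits_of L x) i = x %/ 2 ^ (i * w) %% 2 ^ w.
Proof.
move=> xL; rewrite -sum_binary_digits; apply: eq_bigr => j _.
rewrite -divn_exp2; congr (nat_of_bool _ * _).
(* Past the end of the string the padding bit is [false], and [x < 2 ^ L] makes the digit of [x]
   zero as well. *)
have [lt|ge] := ltnP (i * w + j) L; first by rewrite nth_mkseq.
rewrite nth_default ?size_mkseq // divn_small //.
by apply: leq_trans xL _; rewrite leq_exp2l.
Qed.

Definition extract (S p b : nat) : nat := S %/ 2 ^ p %% 2 ^ b.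

Lemma extract_sub S p b p' b' :
  p' + b' <= b -> extract S (p + p') b' = extract S p b %/ 2 ^ p' %% 2 ^ b'.
Proof.
move=> le; rewrite /extract divn_exp2.
set Y := S %/ 2 ^ p.
by rewrite -[RHS]divn_modn_exp2 modn_exp2_le // divn_modn_exp2.
Qed.

(* The shifts by [w - off] and [off] glue two consecutive words; when
   [off = 0] the second word is shifted out entirely. *)
Lemma extract_two_words w S p b :
  0 < w -> b <= w ->
  let word i := S %/ 2 ^ (i * w) %% 2 ^ w in
  let hi := (word (p %/ w).+1 * 2 ^ (w - p %% w)) %% 2 ^ w in
  let lo := word (p %/ w) %/ 2 ^ (p %% w) in
  (lo + hi < 2 ^ w) /\ (lo + hi) %% 2 ^ b = extract S p b.
Proof.
move=> w0 bw word hi lo.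
set i := p %/ w; set o := p %% w.
have ow : o <= w by rewrite ltnW // ltn_pmod.
set Y := S %/ 2 ^ (i * w).
have loE : lo = Y %/ 2 ^ o %% 2 ^ (w - o).
  by rewrite /lo /word -/i -/o -/Y -divn_modn_exp2 subnKC.
have hiE : hi = 2 ^ (w - o) * (Y %/ 2 ^ w %% 2 ^ o).
  have shl y : (y * 2 ^ (w - o)) %% 2 ^ w = 2 ^ (w - o) * (y %% 2 ^ o).
    by rewrite -[w in _ %% 2 ^ w](subnK ow) expnD mulnC -muln_modr.
  by rewrite /hi /word -/i -/o shl modn_exp2_le // mulSn addnC divn_exp2.
have E : lo + hi = Y %/ 2 ^ o %% 2 ^ w.
  rewrite loE hiE -[in RHS](subnK ow) modn_exp2_split -divn_exp2.
  by rewrite [o + _]addnC subnK.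
rewrite E ltn_pmod ?expn_gt0 //; split=> //.
by rewrite modn_exp2_le // /extract (divn_eq p w) divn_exp2.
Qed.

Lemma mixed_radix_lt p q a b : a < p -> b < q -> a + p * b < p * q.
Proof. by move=> ap bq; have := leq_mul (leqnn p) bq; rewrite mulnS; lia. Qed.

Lemma mixed_radix_div p a b : a < p -> (a + p * b) %/ p = b.
Proof.
move=> ap; rewrite addnC mulnC divnMDl ?(leq_ltn_trans _ ap) //.
by rewrite divn_small ?addn0.
Qed.

Lemma mixed_radix_mod p a b : a < p -> (a + p * b) %% p = a.
Proof. by move=> ap; rewrite addnC mulnC modnMDl modn_small. Qed.

(** * Merging children into memory bits and a spill *)

Section Spill.

Variables (I : finType) (M K : I -> nat) (Km B : nat).

(** Alternative [i] brings [M i] memory bits and a spill below [K i], so this counts the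
    configurations to be represented. *)
Definition mass : nat := \sum_i 2 ^ M i * K i.
Definition cmem : nat := trunc_log 2 (mass %/ Km).
(** The low bits of the spill fill the memory that alternative [i] leaves free. The cap [B] keeps
    [2 ^ low i] within a word and is harmless: a spill below [2 ^ B] then goes to memory
    entirely. *)
Definition low (i : I) : nat := minn (cmem - M i) B.
Definition share (i : I) : nat := (K i + (2 ^ low i).-1) %/ 2 ^ low i.
Definition shares : seq nat := [seq share i | i <- enum I].
Definition cspill : nat := sumn shares.
(** Intervals of lengths [share i] are laid end to end, so the parent's spill reveals both the
    alternative and the high part of its spill. *)
Definition spill_code (i : I) (t : nat) : nat :=
  flatten_index shares (enum_rank i) (t %/ 2 ^ low i).

Hypothesis Km_gt0 : 0 < Km.
Hypothesis K_le : forall i, K i <= 2 ^ B.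
Hypothesis M_gt0 : forall i, 0 < M i -> 0 < K i -> Km <= K i.

Lemma cspillE : cspill = \sum_i share i.
Proof. by rewrite /cspill sumnE big_map big_enum. Qed.

Lemma share_ge i : K i <= share i * 2 ^ low i.
Proof.
have p0 : 0 < 2 ^ low i by rewrite expn_gt0.
rewrite /share; have := divn_eq (K i + (2 ^ low i).-1) (2 ^ low i).
have := ltn_pmod (K i + (2 ^ low i).-1) p0; move: p0.
by move: (2 ^ _) => p p0; move: (_ %/ _) (_ %% _) => q r; lia.
Qed.

Lemma share_lt i t : t < K i -> t %/ 2 ^ low i < share i.
Proof.
by move=> lt; rewrite ltn_divLR ?expn_gt0 // (leq_trans lt) // share_ge.
Qed.

Lemma cmem_le : 0 < cmem -> 2 ^ cmem * Km <= mass.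
Proof.
move=> c0; rewrite -leq_divRL //; apply: trunc_logP => //.
by rewrite lt0n; apply: contraTneq c0 => e; rewrite /cmem e trunc_log0.
Qed.

Lemma mass_lt : mass < 2 ^ cmem * (2 * Km).
Proof.
have := trunc_log_ltn (mass %/ Km) (p := 2) isT.
by rewrite ltn_divLR // expnS mulnCA mulnA.
Qed.

(** An alternative with memory has at least [Km] spills, so its share of the mass alone already
    allows [M i] bits. *)
Lemma M_le_cmem i : 0 < K i -> M i <= cmem.
Proof.
move=> K0; case: (posnP (M i)) => [->//|M0].
apply: trunc_log_max => //; rewrite leq_divRL //.
apply: leq_trans (_ : 2 ^ M i * K i <= _); first by rewrite leq_mul ?M_gt0.
by rewrite /mass (bigD1 i) //= leq_addr.
Qed.

(** Rounding up wastes at most one spill value per alternative, that is [2 ^ cmem] configurations.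
    When [cmem = 0] nothing is shifted out and nothing is wasted. *)
Lemma share_le i : 2 ^ cmem * share i <= 2 ^ M i * K i + 2 ^ cmem * (0 < cmem).
Proof.
case: (posnP (K i)) => [Ki0|K0].
  rewrite /share Ki0 add0n divn_small ?muln0 //.
  by rewrite prednK ?expn_gt0.
have Mi := M_le_cmem K0.
case: (posnP cmem) => [c0|c0].
  rewrite /share /low c0 min0n expn0 addn0 divn1 mul1n muln0 addn0.
  by rewrite leq_pmull ?expn_gt0.
rewrite /= muln1 /share /low; case: (leqP (cmem - M i) B) => cB.
  set p := 2 ^ (cmem - M i).
  have -> : 2 ^ cmem = 2 ^ M i * p by rewrite -expnD subnKC.
  have := leq_divM (K i + p.-1) p.
  have p0 : 0 < p by rewrite expn_gt0.
  move: (_ %/ _) => q; rewrite [q * p]mulnC -mulnA -mulnDr => qp.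
  rewrite leq_mul2l; apply/orP; right; lia.
have KB := K_le i.
suff le1 : (K i + (2 ^ B).-1) %/ 2 ^ B <= 1.
  by apply: leq_trans (leq_mul (leqnn _) le1) _; rewrite muln1 leq_addl.
rewrite -ltnS ltn_divLR ?expn_gt0 //.
have : 0 < 2 ^ B by rewrite expn_gt0.
lia.
Qed.

Lemma cspill_mass : 2 ^ cmem * cspill <= mass + #|I| * 2 ^ cmem * (0 < cmem).
Proof.
rewrite cspillE big_distrr /mass /=.
apply: (@leq_trans (\sum_i (2 ^ M i * K i + 2 ^ cmem * (0 < cmem)))).
  by apply: leq_sum => i _; apply: share_le.
by rewrite big_split /= leq_add2l sum_nat_const mulnA.
Qed.

Lemma cspill_lt : cspill < 2 * Km + #|I|.
Proof.
have p0 : 0 < 2 ^ cmem by rewrite expn_gt0.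
rewrite -(ltn_pmul2l p0).
apply: leq_ltn_trans cspill_mass _; have := mass_lt.
by case: (0 < cmem); nia.
Qed.

(** With memory present, [mass] is at least [2 ^ cmem * Km], so wasting [2 ^ cmem] per alternative
    is a relative loss of [#|I| / Km]. *)
Lemma cspill_loss : 2 ^ cmem * cspill * Km <= mass * (Km + #|I|).
Proof.
have := cspill_mass; have := cmem_le; case: (0 < cmem) => /= H1 H2.
  by have := H1 isT; nia.
by nia.
Qed.

Lemma cspill_ge : 0 < cmem -> Km <= cspill.
Proof.
move=> c0; have p0 : 0 < 2 ^ cmem by rewrite expn_gt0.
rewrite -(leq_pmul2l p0).
apply: leq_trans (cmem_le c0) _; rewrite /mass cspillE big_distrr /=.
apply: leq_sum => i _; case: (posnP (K i)) => [->|K0]; first by rewrite muln0.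
apply: leq_trans (leq_mul (leqnn _) (share_ge i)) _.
rewrite mulnCA mulnC leq_mul2r; apply/orP; right.
rewrite -expnD leq_exp2l // -[leqRHS](subnKC (M_le_cmem K0)).
by rewrite leq_add2l geq_minl.
Qed.

Lemma nth_shares i : nth 0 shares (enum_rank i) = share i.
Proof.
by rewrite (nth_map i) ?nth_enum_rank // -cardE.
Qed.

Lemma spill_code_lt i t : t < K i -> spill_code i t < cspill.
Proof. by move=> lt; apply: flatten_indexP; rewrite nth_shares share_lt. Qed.

Lemma spill_codeKl i t : t < K i ->
  reshape_index shares (spill_code i t) = enum_rank i.
Proof. by move=> lt; apply: flatten_indexKl; rewrite nth_shares share_lt. Qed.

Lemma spill_codeKr i t : t < K i ->
  reshape_offset shares (spill_code i t) = t %/ 2 ^ low i.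
Proof. by move=> lt; apply: flatten_indexKr; rewrite nth_shares share_lt. Qed.

End Spill.

(** * A prefix code from the Kraft inequality *)

Lemma count_residue a b c :
  b <= a -> \sum_(x < 2 ^ a) (x %% 2 ^ b == c) <= 2 ^ (a - b).
Proof.
move=> ba.
have -> : \sum_(x < 2 ^ a) (x %% 2 ^ b == c) =
    #|[pred x : 'I_(2 ^ a) | x %% 2 ^ b == c]|.
  rewrite -sum1_card [RHS]big_mkcond; apply: eq_bigr => x _.
  by rewrite inE; case: (_ == c).
have lt (x : 'I_(2 ^ a)) : x %/ 2 ^ b < 2 ^ (a - b).
  by rewrite ltn_divLR ?expn_gt0 // -expnD subnK.
rewrite -[leqRHS]card_ord.
apply: (@leq_card_in _ _ (fun x => Ordinal (lt x))) => x y.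
rewrite !inE => /eqP xc /eqP yc [xy]; apply: val_inj => /=.
by rewrite (divn_eq x (2 ^ b)) (divn_eq y (2 ^ b)) xc yc xy.
Qed.

(* Longer codewords are chosen last, so that the residue classes already taken
   are unions of classes modulo the current [2 ^ a i]. *)
Lemma kraft_seq (I : eqType) (a : I -> nat) (L : nat) (s : seq I) :
  sorted (fun i j => a j <= a i) s -> (forall i, i \in s -> a i <= L) ->
  \sum_(i <- s) 2 ^ (L - a i) <= 2 ^ L ->
  exists c : I -> nat, (forall i, i \in s -> c i < 2 ^ a i) /\
    (forall i j, i \in s -> j \in s -> i != j -> a i <= a j ->
       c j %% 2 ^ a i != c i).
Proof.
elim: s => [|h s IH] /=; first by exists (fun=> 0).
rewrite path_sortedE; last by move=> i j k ij jk; apply: leq_trans jk ij.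
move=> /andP[/allP le_h srt] leL; rewrite big_cons => sumL.
have [||c [c_lt c_free]] := IH srt.
- by move=> i si; rewrite leL // inE si orbT.
- by apply: leq_trans sumL; rewrite leq_addl.
have hL : a h <= L by rewrite leL ?mem_head.
(* If every candidate were taken, the residue classes of the codewords in [s] would already exhaust
   [2 ^ L], leaving no room for the positive term of [h]. *)
have [x x_free] : exists x : 'I_(2 ^ a h), all (fun j => x %% 2 ^ a j != c j) s.
  apply/existsP; apply: contraLR sumL => /existsPn none; rewrite -ltnNge.
  suff le : 2 ^ L <= \sum_(j <- s) 2 ^ (L - a j).
    by apply: leq_ltn_trans le _; rewrite -[ltnLHS]add0n ltn_add2r expn_gt0.
  have -> : 2 ^ L = 2 ^ (L - a h) * \sum_(x < 2 ^ a h) 1.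
    by rewrite sum1_card card_ord -expnD subnK.
  apply: (@leq_trans (2 ^ (L - a h) *
            \sum_(j <- s) \sum_(x < 2 ^ a h) (x %% 2 ^ a j == c j))).
    rewrite leq_mul2l exchange_big leq_sum ?orbT //= => x _.
    have /allPn[j js] := none x; rewrite negbK => xj.
    by rewrite (big_rem j) //= xj.
  rewrite big_distrr /= big_seq [leqRHS]big_seq leq_sum // => j js.
  have ajh := le_h _ js.
  apply: leq_trans (leq_mul (leqnn _) (count_residue _ ajh)) _.
  by rewrite -expnD leq_exp2l // addnBA // subnK.
exists (fun i => if i == h then val x else c i); split=> [i|i j].
  by rewrite inE; case: eqP => [->|_] //=; apply: c_lt.
rewrite !inE; case: (eqVneq i h) => [->|ih]; case: (eqVneq j h) => [->|jh] //=.
- move=> _ js _ hj; have jE : a j = a h.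
    by apply/eqP; rewrite eqn_leq hj le_h.
  have := allP x_free _ js; rewrite jE !modn_small ?ltn_ord //.
    by rewrite eq_sym.
  by rewrite -jE c_lt.
- by move=> si _ _ _; apply: allP x_free _ si.
- by move=> si sj; apply: c_free.
Qed.

(** Codewords are read from their low bits, so prefix-freeness becomes a statement about
    residues. *)
Lemma kraft (I : finType) (P : pred I) (a : I -> nat) (L : nat) :
  (forall i, P i -> a i <= L) -> \sum_(i | P i) 2 ^ (L - a i) <= 2 ^ L ->
  exists c : I -> nat, (forall i, P i -> c i < 2 ^ a i) /\
    (forall i j, P i -> P j -> i != j -> a i <= a j -> c j %% 2 ^ a i != c i).
Proof.
move=> leL sumL; pose r i j := a j <= a i; pose s := sort r (enum P).
have sP i : (i \in s) = P i by rewrite mem_sort mem_enum.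
have [|i||c [c_lt c_free]] := @kraft_seq _ a L s.
- by apply: sort_sorted => i j; apply: leq_total.
- by rewrite sP; apply: leL.
- rewrite (perm_big (enum P)) ?perm_sort //= big_enum /=.
  by move: sumL; rewrite (eq_bigl P).
by exists c; split=> [i|i j]; rewrite -?sP; [apply: c_lt|apply: c_free].
Qed.

(** * The recursive code of a walk *)

Section WalkCode.

Variables (V : finType) (e : rel V) (cost : V -> nat) (Lm Km B : nat).

(* [(y1, x2, l1)]: the left half ends in [y1] at total cost [l1] and the right
   half starts in [x2]. *)
Definition walk_split : finType := (V * V * 'I_Lm)%type.

(** A single vertex needs no information beyond its label; an impossible label gets the empty spill
    universe. *)
Definition leaf_dims (x y : V) (l : nat) : nat * nat :=
  (0, nat_of_bool ((x == y) && (l == 0))).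

(* The number of memory bits and the size of the spill universe for the walks
   with [m] vertices from [x] to [y], of total cost [l], the last vertex not
   being charged; [h] bounds the depth of the halving. *)
Fixpoint dims (h m : nat) (x y : V) (l : nat) : nat * nat :=
  if h is h'.+1 then
    if m <= 1 then leaf_dims x y l else
    let left (c : walk_split) := dims h' m./2 x c.1.1 c.2 in
    let right (c : walk_split) :=
      dims h' (m - m./2) c.1.2 y (l - (c.2 + cost c.1.1)) in
    let M c := (left c).1 + (right c).1 in
    let K (c : walk_split) := if e c.1.1 c.1.2 && (c.2 + cost c.1.1 <= l)
               then (left c).2 * (right c).2 else 0 in
    (cmem M K Km, cspill M K Km B)
  else leaf_dims x y l.

Definition bits h m x y l : nat := (dims h m x y l).1.
Definition spill h m x y l : nat := (dims h m x y l).2.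

Section Node.

Variables (h m : nat) (x y : V) (l : nat).

Definition rcost (c : walk_split) : nat := l - (c.2 + cost c.1.1).
Definition ok_split (c : walk_split) : bool :=
  e c.1.1 c.1.2 && (c.2 + cost c.1.1 <= l).
Definition lbits (c : walk_split) : nat := bits h m./2 x c.1.1 c.2.
Definition rbits (c : walk_split) : nat := bits h (m - m./2) c.1.2 y (rcost c).
Definition lspill (c : walk_split) : nat := spill h m./2 x c.1.1 c.2.
Definition rspill (c : walk_split) : nat :=
  spill h (m - m./2) c.1.2 y (rcost c).
Definition node_bits (c : walk_split) : nat := lbits c + rbits c.
Definition node_spill (c : walk_split) : nat :=
  if ok_split c then lspill c * rspill c else 0.

Lemma bits_node :
  1 < m -> bits h.+1 m x y l = cmem node_bits node_spill Km.
Proof. by rewrite /bits /= ltnNge; case: leqP. Qed.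

Lemma spill_node :
  1 < m -> spill h.+1 m x y l = cspill node_bits node_spill Km B.
Proof. by rewrite /spill /= ltnNge; case: leqP. Qed.

End Node.

Lemma dims_leaf h m x y l : m <= 1 -> dims h m x y l = leaf_dims x y l.
Proof. by case: h => //= h ->. Qed.

Hypothesis Km_gt0 : 0 < Km.
Hypothesis split_le : #|{: walk_split}| <= Km.
Hypothesis B_ge : (3 * Km) * (3 * Km) <= 2 ^ B.

(** The invariant carried up the tree: the bounds for the two halves supply the hypotheses [K_le]
    and [M_gt0] of the merge at their parent. *)
Definition spill_range (h : nat) : Prop := forall m x y l,
  spill h m x y l <= 3 * Km /\ (0 < bits h m x y l -> Km <= spill h m x y l).

Lemma node_spill_le h m x y l c :
  spill_range h -> node_spill h m x y l c <= 2 ^ B.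
Proof.
move=> range; rewrite /node_spill; case: ifP => // _; apply: leq_trans B_ge.
have [H1 _] := range m./2 x c.1.1 c.2.
have [H2 _] := range (m - m./2) c.1.2 y (rcost l c).
exact: leq_mul.
Qed.

Lemma node_spill_ge h m x y l c : spill_range h ->
  0 < node_bits h m x y l c -> 0 < node_spill h m x y l c ->
  Km <= node_spill h m x y l c.
Proof.
move=> range; rewrite /node_spill; case: ifP => // _.
have [_ H1] := range m./2 x c.1.1 c.2.
have [_ H2] := range (m - m./2) c.1.2 y (rcost l c).
rewrite addn_gt0 muln_gt0 => /orP[/H1|/H2] le /andP[k1 k2].
  by rewrite -[Km]muln1 leq_mul.
by rewrite -[Km]mul1n leq_mul.
Qed.

Lemma spill_rangeP h : spill_range h.
Proof.
elim: h => [|h IH] m x y l.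
  by rewrite /bits /spill /=; split=> //; case: (_ && _) => //; lia.
have [m1|m1] := leqP m 1.
  by rewrite /bits /spill dims_leaf //=; split=> //; case: (_ && _) => //; lia.
rewrite bits_node // spill_node //.
have K_le c := @node_spill_le h m x y l c IH.
have M_gt0 c := @node_spill_ge h m x y l c IH.
split=> [|c0]; last by apply: cspill_ge.
have := cspill_lt Km_gt0 K_le M_gt0; move: split_le; rewrite /walk_split; lia.
Qed.

Lemma spill_le h m x y l : spill h m x y l <= 3 * Km.
Proof. by have [] := @spill_rangeP h m x y l. Qed.

(** * Generating functions of the capacities *)

Section Weight.

Variables (R : realFieldType) (b : R).
Local Open Scope ring_scope.

Definition capacity h m x y l : nat := (2 ^ bits h m x y l * spill h m x y l)%N.

(** With exact numbers of walks in place of capacities, this would add up the (sub)probabilities of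
    the walks from [x]. *)
Definition weight (h m : nat) (x : V) : R :=
  \sum_y \sum_(l < Lm) b ^+ l * (capacity h m x y l)%:R.

Definition loss : R := (Km + #|{: walk_split}|)%:R / Km%:R.

Hypothesis b_ge0 : 0 <= b.
Hypothesis b_cost : forall x, b ^+ cost x * (outdeg e x)%:R <= 1.

Lemma loss_ge1 : 1 <= loss.
Proof. by rewrite ler_pdivlMr ?ltr0n // mul1r ler_nat leq_addr. Qed.

Lemma weight_leaf h m x : dims h m x =2 leaf_dims x -> weight h m x <= 1.
Proof.
move=> leafE; rewrite /weight (bigD1 x) //= [X in _ + X]big1 ?addr0.
  case: Lm => [|L]; first by rewrite big_ord0.
  rewrite big_ord_recl /= expr0 mul1r [X in _ + X]big1 ?addr0.
    by rewrite /capacity /bits /spill leafE /= !eqxx.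
  by move=> i _; rewrite /capacity /bits /spill leafE /= andbF muln0 mulr0.
move=> y yx; apply: big1 => i _.
by rewrite /capacity /bits /spill leafE /= eq_sym (negPf yx) muln0 mulr0.
Qed.

(** Memory bits add and spills multiply, so the capacities of the halves multiply; [loss] is the
    relative waste of one merge. *)
Lemma capacity_node h m x y l : (1 < m)%N ->
  (capacity h.+1 m x y l)%:R <= loss * \sum_(c : walk_split | ok_split l c)
    (capacity h m./2 x c.1.1 c.2)%:R *
    (capacity h (m - m./2) c.1.2 y (rcost l c))%:R.
Proof.
move=> m1; rewrite /loss mulrAC ler_pdivlMr ?ltr0n // -natrM.
rewrite /capacity bits_node // spill_node //.
apply: le_trans (_ : (mass (node_bits h m x y l) (node_spill h m x y l) *
                        (Km + #|{: walk_split}|))%:R <= _).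
  rewrite ler_nat; apply: cspill_loss => // c.
    by apply: node_spill_le; apply: spill_rangeP.
  by apply: node_spill_ge; apply: spill_rangeP.
rewrite natrM mulrC; apply: ler_wpM2l; first by rewrite ler0n.
rewrite /mass natr_sum [leRHS]big_mkcond /=; apply: ler_sum => c _.
rewrite /node_spill; case: ifP => _; last by rewrite muln0.
by rewrite /node_bits expnD mulnACA natrM.
Qed.

(** Equality would hold for full series; truncation at [Lm] only drops nonnegative terms on the
    left. *)
Lemma shifted_sum (f : nat -> R) (d : nat) : (forall l, 0 <= f l) ->
  \sum_(l < Lm | (d <= l)%N) b ^+ l * f (l - d)%N <=
  b ^+ d * \sum_(l < Lm) b ^+ l * f l.
Proof.
move=> f0; have [dL|Ld] := leqP d Lm; last first.
  rewrite big1 => [|l dl]; last by have := ltn_ord l; lia.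
  apply: mulr_ge0; rewrite ?sumr_ge0 ?exprn_ge0 // => i _.
  by rewrite mulr_ge0 ?exprn_ge0.
rewrite -(big_mkord (fun l => d <= l)%N (fun l => b ^+ l * f (l - d)%N)).
rewrite (big_cat_nat (n := d)) //= big_nat_cond big1 ?add0r; last first.
  by move=> i; lia.
rewrite -{1}[d]add0n big_addn mulr_sumr.
rewrite -(big_mkord xpredT (fun l => b ^+ d * (b ^+ l * f l))).
rewrite [leRHS](big_cat_nat (n := (Lm - d)%N)) ?leq_subr //=.
rewrite -[leLHS]addr0 lerD //.
  rewrite big_mkcond /=; apply: ler_sum => i _.
  by rewrite leq_addl addnK exprD mulrA [b ^+ d * _]mulrC.
by apply: sumr_ge0 => i _; rewrite !mulr_ge0 ?exprn_ge0.
Qed.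

(** A tree with [m] leaves has [m.-1] merges, each costing a factor [loss], while the choice of each
    next vertex is paid for by [b_cost]. *)
Lemma weight_le h m x : (0 < m)%N -> weight h m x <= loss ^+ m.-1.
Proof.
elim: h m x => [|h IH] m x m0.
  by apply: le_trans (weight_leaf _) _ => //; rewrite exprn_ege1 ?loss_ge1.
have [m1|m1] := leqP m 1.
  apply: le_trans (weight_leaf _) _; last by rewrite exprn_ege1 ?loss_ge1.
  by move=> y l; apply: dims_leaf.
have h1 : (0 < m./2)%N by lia.
have h2 : (0 < m - m./2)%N by lia.
have -> : m.-1 = (1 + ((m./2).-1 + (m - m./2).-1))%N by lia.
rewrite exprD expr1.
pose A (y1 : V) (l1 : nat) := (capacity h m./2 x y1 l1)%:R : R.
pose C (x2 y : V) (l2 : nat) := (capacity h (m - m./2) x2 y l2)%:R : R.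
have step1 : weight h.+1 m x <= loss * \sum_(c : walk_split | e c.1.1 c.1.2)
    A c.1.1 c.2 * \sum_y \sum_(l < Lm | (c.2 + cost c.1.1 <= l)%N)
      b ^+ l * C c.1.2 y (rcost l c).
  apply: le_trans (_ : \sum_y \sum_(l < Lm) b ^+ l * (loss *
     \sum_(c : walk_split | ok_split l c)
       A c.1.1 c.2 * C c.1.2 y (rcost l c)) <= _).
    apply: ler_sum => y _; apply: ler_sum => l _.
    by apply: ler_wpM2l; rewrite ?exprn_ge0 ?capacity_node.
  rewrite le_eqVlt; apply/orP; left; apply/eqP.
  under eq_bigr => y _.
    under eq_bigr => l _ do rewrite mulrCA mulr_sumr.
    rewrite -mulr_sumr; over.
  rewrite -mulr_sumr; congr (_ * _).
  under eq_bigr => y _.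
    under eq_bigr => l _ do rewrite big_mkcondr /=.
    rewrite exchange_big /=; over.
  rewrite exchange_big /=; apply: eq_bigr => c _.
  rewrite mulr_sumr; apply: eq_bigr => y _.
  rewrite mulr_sumr [RHS]big_mkcond /=; apply: eq_bigr => l _.
  by case: ifP => // _; rewrite mulrCA.
apply: le_trans step1 _; apply: ler_wpM2l; first by apply: le_trans loss_ge1.
have A0 y1 l1 : 0 <= A y1 l1 by rewrite ler0n.
have C0 x2 y l2 : 0 <= C x2 y l2 by rewrite ler0n.
(* The right half is summed out: the cost shift leaves the series as a power of [b], and the
   induction hypothesis bounds the rest. *)
apply: le_trans (_ : \sum_(c : walk_split | e c.1.1 c.1.2)
    A c.1.1 c.2 * (b ^+ (c.2 + cost c.1.1) * loss ^+ (m - m./2).-1) <= _).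
  apply: ler_sum => c _; apply: ler_wpM2l => //.
  apply: le_trans
    (_ : _ <= b ^+ (c.2 + cost c.1.1) * weight h (m - m./2) c.1.2) _.
    rewrite /weight mulr_sumr; apply: ler_sum => y _.
    exact: (@shifted_sum (fun l => C c.1.2 y l)).
  by apply: ler_wpM2l; rewrite ?exprn_ge0 ?IH.
rewrite exprD; apply: le_trans (ler_wpM2r _ (IH _ x h1)); last first.
  by rewrite exprn_ge0 // (le_trans _ loss_ge1).
rewrite big_mkcond /=.
rewrite -(pair_bigA _ (fun (p : V * V) (l1 : 'I_Lm) =>
  if e p.1 p.2 then A p.1 (val l1) *
  (b ^+ (val l1 + cost p.1) * loss ^+ (m - m./2).-1) else 0)) /=.
rewrite -(pair_bigA _ (fun y1 x2 => \sum_l1 if e y1 x2 then A y1 (val l1) *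
  (b ^+ (val l1 + cost y1) * loss ^+ (m - m./2).-1) else 0)) /=.
rewrite /weight mulr_suml; apply: ler_sum => y1 _.
set D := loss ^+ (m - m./2).-1.
have D0 : 0 <= D by rewrite exprn_ge0 // (le_trans _ loss_ge1).
rewrite exchange_big mulr_suml /=; apply: ler_sum => l1 _.
(* The bound no longer depends on [x2], so summing over the successors of [y1] yields its
   out-degree. *)
rewrite -big_mkcond sumr_const /=.
have -> : #|[pred x2 | e y1 x2]| = outdeg e y1.
  by apply: eq_card => x2; rewrite !inE.
rewrite -[leLHS]mulr_natr exprD -/(A y1 l1).
have -> : A y1 l1 * (b ^+ l1 * b ^+ cost y1 * D) * (outdeg e y1)%:R =
          b ^+ l1 * A y1 l1 * D * (b ^+ cost y1 * (outdeg e y1)%:R) by ring.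
apply: ler_piMr; last exact: b_cost.
by rewrite mulr_ge0 // mulr_ge0 // exprn_ge0.
Qed.

End Weight.

End WalkCode.

(** * The query program *)

(* Registers: 0 query, 1 address of the current record, 2 bit position of the
   current segment, 3 word size, 4 address of the bit string, 5 the constant 1,
   6 the constant 0, 7 the record size 8; 11 to 18 receive the fields of the
   record.  The jump targets are 5 (main loop), 41 (left child), 45 (leaf). *)
Definition walk_program : program :=
  [:: ILoad 3 6; IConst 5 1; ILoad 4 5; IConst 1 8; IConst 7 8;
   (* 5 *)
   ILoad 11 1; IBinop OpAdd 1 1 5; ILoad 12 1; IJumpEq 12 6 45;
   IBinop OpAdd 1 1 5; ILoad 13 1; IBinop OpAdd 1 1 5; ILoad 14 1;
   IBinop OpAdd 1 1 5; ILoad 15 1; IBinop OpAdd 1 1 5; ILoad 16 1;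
   IBinop OpAdd 1 1 5; ILoad 17 1; IBinop OpAdd 1 1 5; ILoad 18 1;
   IBinop OpAdd 13 2 13; IBinop OpDiv 19 13 3; IBinop OpAdd 19 4 19;
   ILoad 20 19; IBinop OpAdd 19 19 5; ILoad 21 19; IBinop OpMod 13 13 3;
   IBinop OpShr 20 20 13; IBinop OpSub 13 3 13; IBinop OpShl 21 21 13;
   IBinop OpAdd 20 20 21; IBinop OpMod 20 20 14; IBinop OpAdd 20 20 15;
   IJumpLt 0 11 41;
   IBinop OpMod 20 20 12; IBinop OpMul 20 20 7; IBinop OpAdd 1 17 20;
   IBinop OpAdd 2 2 18; IBinop OpSub 0 0 11; IJump 5;
   (* 41 *)
   IBinop OpDiv 20 20 12; IBinop OpMul 20 20 7; IBinop OpAdd 1 16 20; IJump 5;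
   (* 45 *)
   IMove 0 11; IHalt].

Lemma halted_iter w P s k : halted P s -> iter k (step w P) s = s.
Proof.
move=> hs; elim: k => //= k ->; case: s hs => p r m.
by rewrite /halted /step; case: (fetch P _).
Qed.

(* Symbolic execution: [L] lists known register contents, latest first. *)
Fixpoint known (L : seq (nat * nat)) (i : nat) : option nat :=
  if L is (j, x) :: L' then if i == j then Some x else known L' i else None.

Section Machine.

Variables (w : nat) (P : program) (mem : nat -> nat).

Definition at_state (s : state) (p : nat) (L : seq (nat * nat)) : Prop :=
  [/\ pc s = p, memory s = mem & forall i x, known L i = Some x -> reg s i = x].

Section Step.

Variables (s : state) (p : nat) (L : seq (nat * nat)).
Hypothesis sP : at_state s p L.

Lemma known_upd (r : nat -> nat) d v :
  (forall i x, known L i = Some x -> r i = x) ->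
  forall i x, known ((d, v) :: L) i = Some x -> upd r d v i = x.
Proof. by move=> H i x /=; rewrite /upd; case: eqP => [_ [->]|_ /H]. Qed.

Lemma at_const d c : nth IHalt P p = IConst d c -> c < 2 ^ w ->
  at_state (step w P s) p.+1 ((d, c) :: L).
Proof.
case: s sP => p' r m [/= -> -> H] Pp lt; rewrite /step /fetch /= Pp.
by rewrite modn_small //; split=> //=; apply: known_upd.
Qed.

Lemma at_move d a x : nth IHalt P p = IMove d a -> known L a = Some x ->
  at_state (step w P s) p.+1 ((d, x) :: L).
Proof.
case: s sP => p' r m [/= -> -> H] Pp /H ax; rewrite /step /fetch /= Pp ax.
by split=> //=; apply: known_upd.
Qed.

Lemma at_binop op d a b x y v : nth IHalt P p = IBinop op d a b ->
  known L a = Some x -> known L b = Some y -> eval_binop w op x y = v ->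
  at_state (step w P s) p.+1 ((d, v) :: L).
Proof.
case: s sP => p' r m [/= -> -> H] Pp /H ax /H bx <-.
rewrite /step /fetch /= Pp ax bx.
by split=> //=; apply: known_upd.
Qed.

Lemma at_load d a x v : nth IHalt P p = ILoad d a -> known L a = Some x ->
  mem x = v -> at_state (step w P s) p.+1 ((d, v) :: L).
Proof.
case: s sP => p' r m [/= -> -> H] Pp /H ax <-; rewrite /step /fetch /= Pp ax.
by split=> //=; apply: known_upd.
Qed.

Lemma at_jump l : nth IHalt P p = IJump l -> at_state (step w P s) l L.
Proof.
by case: s sP => p' r m [/= -> -> H] Pp; rewrite /step /fetch /= Pp; split.
Qed.

Lemma at_jumplt a b l x y : nth IHalt P p = IJumpLt a b l ->
  known L a = Some x -> known L b = Some y ->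
  at_state (step w P s) (if x < y then l else p.+1) L.
Proof.
case: s sP => p' r m [/= -> -> H] Pp /H ax /H bx.
by rewrite /step /fetch /= Pp ax bx; split.
Qed.

Lemma at_jumpeq a b l x y : nth IHalt P p = IJumpEq a b l ->
  known L a = Some x -> known L b = Some y ->
  at_state (step w P s) (if x == y then l else p.+1) L.
Proof.
case: s sP => p' r m [/= -> -> H] Pp /H ax /H bx.
by rewrite /step /fetch /= Pp ax bx; split.
Qed.

End Step.

Lemma at_weaken s p L L' :
  at_state s p L -> all (fun ix => known L ix.1 == Some ix.2) L' ->
  at_state s p L'.
Proof.
case=> pE mE H sub; split=> // i x; elim: L' sub => //= -[j y] L' IH.
case/andP=> /eqP jy /IH; case: eqP => [->|//] _ [<-]; exact: H.
Qed.

End Machine.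

Section WalkProgram.

Variables (w start : nat) (mem : nat -> nat) (S : nat).
Hypothesis w_gt0 : 0 < w.
Hypothesis mem_word : forall i, mem (start + i) = S %/ 2 ^ (i * w) %% 2 ^ w.

Notation run k := (iter k (step w walk_program)).
Notation const := (at_const (w := w) (P := walk_program)).
Notation move_reg := (at_move w (P := walk_program)).
Notation binop := (at_binop (w := w) (P := walk_program)).
Notation load := (at_load w (P := walk_program)).
Notation jump := (at_jump w (P := walk_program)).
Notation jumplt := (at_jumplt w (P := walk_program)).
Notation jumpeq := (at_jumpeq w (P := walk_program)).

Definition in_loop (s : state) (q addr base : nat) : Prop :=
  at_state mem s 5 [:: (0, q); (1, addr); (2, base); (3, w); (4, start);
                       (5, 1); (6, 0); (7, 8)].

Lemma loop_init q : mem 0 = w -> mem 1 = start -> 8 < 2 ^ w ->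
  in_loop (run 5 (State 0 (fun r => if r == 0 then q else 0) mem)) q 8 0.
Proof.
move=> m0 m1 w8; set s := State _ _ _.
have H : at_state mem s 0 [:: (0, q); (1, 0); (2, 0); (6, 0)].
  split=> // -[|[|[|[|[|[|[|i]]]]]]] //= x [<-] //.
have {}H := load H erefl erefl m0.
have {}H := const H erefl (ltnW (leq_ltn_trans (isT : 1 < 8) w8)).
have {}H := load H erefl erefl m1.
have {}H := const H erefl w8.
have {}H := const H erefl w8.
by apply: at_weaken H _; rewrite /= !eqxx.
Qed.

Section Record.

Variables (s : state) (q addr base : nat).
Hypothesis s_loop : in_loop s q addr base.

Lemma loop_leaf : addr + 1 < 2 ^ w -> mem (addr + 1) = 0 ->
  halted walk_program (run 5 s) /\ reg (run 5 s) 0 = mem addr.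
Proof.
move=> lt K0.
have H := load s_loop erefl erefl erefl.
have {}H := binop H erefl erefl erefl (modn_small lt).
have {}H := load H erefl erefl K0.
have {}H := jumpeq H erefl erefl erefl.
have {}H := move_reg H erefl erefl.
case: H => pcE memE regE; split; last exact: regE.
by rewrite /halted /fetch pcE.
Qed.

Variables (m1 K2 off b hi p1 p2 M1 : nat).

(* For a segment with [m1] vertices in its left half: [K2] is the spill
   universe of the right half ([0] in a leaf record, whose first field is the
   answer), [b] bits at offset [off] complete [hi] to the pair of spills, [p1]
   and [p2] point to the records of the halves, and [M1] is the offset of the
   right one. *)
Definition record_at : Prop :=
  [/\ mem addr = m1, mem (addr + 1) = K2,
      [/\ mem (addr + 2) = off, mem (addr + 3) = 2 ^ b & mem (addr + 4) = hi] &
      [/\ mem (addr + 5) = p1, mem (addr + 6) = p2 & mem (addr + 7) = M1]].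

Let t := hi + extract S (base + off) b.

Hypothesis recP : record_at.
Hypothesis b_le : b <= w.
Hypothesis K2_gt0 : 0 < K2.
Hypothesis addr_lt : addr + 7 < 2 ^ w.
Hypothesis pos_lt : start + (base + off) + 1 < 2 ^ w.
Hypothesis t_lt : t < 2 ^ w.

(** The bits needed lie in two consecutive words. The table stores [2 ^ b] rather than [b], so one
    [OpMod] isolates them; adding [hi], stored already shifted, restores the merged spill. *)
Lemma loop_read : at_state mem (run 30 s) (if q < m1 then 41 else 35)
  [:: (20, t); (0, q); (2, base); (3, w); (4, start); (5, 1); (6, 0); (7, 8);
      (11, m1); (12, K2); (16, p1); (17, p2); (18, M1)].
Proof.
have [f0 f1 [f2 f3 f4] [f5 f6 f7]] := recP.
have E k : k <= 6 -> (addr + k + 1) %% 2 ^ w = addr + k.+1.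
  by move=> k6; rewrite -addnA addn1 modn_small //; lia.
have E0 : (addr + 1) %% 2 ^ w = addr + 1 by rewrite modn_small //; lia.
have po : (base + off) %% 2 ^ w = base + off by rewrite modn_small //; lia.
have div_le : (base + off) %/ w <= base + off by apply: leq_div.
have wo1 : (start + (base + off) %/ w) %% 2 ^ w = start + (base + off) %/ w.
  by rewrite modn_small //; lia.
have wo2 : (start + (base + off) %/ w + 1) %% 2 ^ w =
    start + ((base + off) %/ w).+1.
  by rewrite -addnA addn1 modn_small //; lia.
have [sum_lt sumE] := extract_two_words S (base + off) w_gt0 b_le.
have sub_lt : (w + 2 ^ w - (base + off) %% w) %% 2 ^ w = w - (base + off) %% w.
  have ow := ltn_pmod (base + off) w_gt0.
  rewrite addnC -addnBA ?(ltnW ow) // modnDl modn_small //.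
  by apply: leq_ltn_trans (leq_subr _ _) _; apply: ltn_expl.
have K20 : (K2 == 0) = false by rewrite -[K2]prednK.
have H := load s_loop erefl erefl f0.
have {}H := binop H erefl erefl erefl E0.
have {}H := load H erefl erefl f1.
have {}H := jumpeq H erefl erefl erefl.
rewrite K20 in H.
have {}H := binop H erefl erefl erefl (E 1 isT).
have {}H := load H erefl erefl f2.
have {}H := binop H erefl erefl erefl (E 2 isT).
have {}H := load H erefl erefl f3.
have {}H := binop H erefl erefl erefl (E 3 isT).
have {}H := load H erefl erefl f4.
have {}H := binop H erefl erefl erefl (E 4 isT).
have {}H := load H erefl erefl f5.
have {}H := binop H erefl erefl erefl (E 5 isT).
have {}H := load H erefl erefl f6.
have {}H := binop H erefl erefl erefl (E 6 isT).
have {}H := load H erefl erefl f7.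
have {}H := binop H erefl erefl erefl po.
have {}H := binop H erefl erefl erefl erefl.
have {}H := binop H erefl erefl erefl wo1.
have {}H := load H erefl erefl (mem_word _).
have {}H := binop H erefl erefl erefl wo2.
have {}H := load H erefl erefl (mem_word _).
have {}H := binop H erefl erefl erefl erefl.
have {}H := binop H erefl erefl erefl erefl.
have {}H := binop H erefl erefl erefl sub_lt.
have {}H := binop H erefl erefl erefl erefl.
have {}H := binop H erefl erefl erefl (modn_small sum_lt).
have {}H := binop H erefl erefl erefl sumE.
have tE : eval_binop w OpAdd (extract S (base + off) b) hi = t.
  by rewrite /= addnC modn_small.
have {}H := binop H erefl erefl erefl tE.
have {}H := jumplt H erefl erefl erefl.
by apply: at_weaken H _; rewrite /= !eqxx.
Qed.

(** With the spills merged as [k1 * K2 + k2], the left spill is the quotient by [K2]. The records of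
    a node are consecutive, 8 words each. *)
Lemma loop_left : q < m1 -> p1 + 8 * (t %/ K2) < 2 ^ w ->
  in_loop (run 34 s) q (p1 + 8 * (t %/ K2)) base.
Proof.
move=> qm lt; have := loop_read; rewrite qm /in_loop (iterD 4 30).
move: (run 30 s) => s' H.
have {}H := binop H erefl erefl erefl erefl.
have E1 : eval_binop w OpMul (t %/ K2) 8 = 8 * (t %/ K2).
  by rewrite /= mulnC modn_small //; lia.
have {}H := binop H erefl erefl erefl E1.
have {}H := binop H erefl erefl erefl (modn_small lt).
have {}H := jump H erefl.
by apply: at_weaken H _; rewrite /= !eqxx.
Qed.

Lemma loop_right : m1 <= q < 2 ^ w -> p2 + 8 * (t %% K2) < 2 ^ w ->
  base + M1 < 2 ^ w ->
  in_loop (run 36 s) (q - m1) (p2 + 8 * (t %% K2)) (base + M1).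
Proof.
move=> /andP[mq qw] lt lt2; have := loop_read.
rewrite ltnNge mq /in_loop (iterD 6 30); move: (run 30 s) => s' H.
have {}H := binop H erefl erefl erefl erefl.
have E1 : eval_binop w OpMul (t %% K2) 8 = 8 * (t %% K2).
  by rewrite /= mulnC modn_small //; lia.
have {}H := binop H erefl erefl erefl E1.
have {}H := binop H erefl erefl erefl (modn_small lt).
have {}H := binop H erefl erefl erefl (modn_small lt2).
have E2 : eval_binop w OpSub q m1 = q - m1.
  rewrite /= addnC -addnBA // modnDl modn_small //.
  by apply: leq_ltn_trans (leq_subr _ _) qw.
have {}H := binop H erefl erefl erefl E2.
have {}H := jump H erefl.
by apply: at_weaken H _; rewrite /= !eqxx.
Qed.

End Record.

End WalkProgram.

(** * The lookup table *)

Section Table.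

Variables (V : finType) (e : rel V) (cost : V -> nat) (L Km B : nat).
Variables (N H w Br : nat).

Notation Lm := L.+1.
Notation Kx := (3 * Km).
Notation bits := (bits e cost Lm Km B).
Notation spill := (spill e cost Lm Km B).
Notation node_bits := (node_bits e cost (Lm := Lm) Km B).
Notation node_spill := (node_spill e cost (Lm := Lm) Km B).
Notation lbits := (lbits e cost (Lm := Lm) Km B).
Notation rbits := (rbits e cost (Lm := Lm) Km B).
Notation lspill := (lspill e cost (Lm := Lm) Km B).
Notation rspill := (rspill e cost (Lm := Lm) Km B).

Definition block : finType := ('I_H.+1 * 'I_N.+1 * V * V * 'I_Lm)%type.
Definition root_state : finType := (V * V * 'I_Lm * 'I_Kx)%type.

Variables (a code : root_state -> nat).

Definition root_ok (r : root_state) : bool :=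
  r.2 < spill H N r.1.1.1 r.1.1.2 r.1.2.

Definition first_node : nat := 2 + 2 ^ Br.
Definition nb_records : nat := first_node + #|{: block}| * Kx.

(** [inord] makes the numbering total; it is faithful within the bounds [H], [N], [L], which the
    lookups assume. *)
Definition slot (h m : nat) (x y : V) (l : nat) : nat :=
  enum_rank ((inord h, inord m, x, y, inord l) : block).
Definition ptr (h m : nat) (x y : V) (l : nat) : nat :=
  8 * (first_node + slot h m x y l * Kx).

Definition split_record (h m : nat) (x y : V) (l hi : nat)
    (c : walk_split V Lm) : seq nat :=
  let M := node_bits h m x y l in
  let K := node_spill h m x y l in
  [:: m./2; rspill h m y l c; M c; 2 ^ low M K Km B c;
      hi * 2 ^ low M K Km B c; ptr h m./2 x c.1.1 c.2;
      ptr h (m - m./2) c.1.2 y (rcost cost l c); lbits h m x c].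

Definition node_record (h m : nat) (x y : V) (l k : nat) : seq nat :=
  if h is h'.+1 then
    if m <= 1 then [:: val (enum_rank x); 0] else
    let sh := shares (node_bits h' m x y l)
                     (node_spill h' m x y l) Km B in
    nth [::] [seq split_record h' m x y l (reshape_offset sh k) c
             | c <- enum (walk_split V Lm)] (reshape_index sh k)
  else [:: val (enum_rank x); 0].

(** The codeword at the low end of [j] identifies the label and spill of the root. The universe of
    size 1 makes the right spill 0, and the last field skips the codeword. *)
Definition root_record (j : nat) : seq nat :=
  if [pick r | root_ok r && (j %% 2 ^ a r == code r)] is Some r then
    [:: 0; 1; 0; 2 ^ 0; 0; 0; ptr H N r.1.1.1 r.1.1.2 r.1.2 + 8 * r.2; a r]
  else [::].

(* A record with [m1 = 0] and no bits to read jumps to its right child. *)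
Definition record (i : nat) : seq nat :=
  if i == 0 then [:: w; 8 * nb_records]
  else if i == 1 then [:: 0; 2 ^ Br; 0; 2 ^ Br; 0; 0; 16; 0]
  else if i < first_node then root_record (i - 2)
  else let j := i - first_node in
    nth [::] [seq node_record b.1.1.1.1 b.1.1.1.2 b.1.1.2 b.1.2 b.2 (j %% Kx)
             | b : block <- enum block] (j %/ Kx).

(** Reduction modulo [2 ^ w] makes every entry a word by construction; the default 0 pads short
    records. *)
Definition table : seq nat :=
  mkseq (fun z => nth 0 (record (z %/ 8)) (z %% 8) %% 2 ^ w) (8 * nb_records).

Lemma size_table : size table = 8 * nb_records.
Proof. exact: size_mkseq. Qed.

Lemma table_lt : all (fun x => x < 2 ^ w) table.
Proof.
by rewrite all_map; apply/allP => x _; rewrite /= ltn_pmod ?expn_gt0.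
Qed.

Definition walk_mem (T S : nat) : nat -> nat := init_mem w table (bits_of T S).

Lemma walk_mem_table T S i j :
  i < nb_records -> j < 8 -> nth 0 (record i) j < 2 ^ w ->
  walk_mem T S (8 * i + j) = nth 0 (record i) j.
Proof.
move=> iR j8 lt.
have ij : 8 * i + j < 8 * nb_records by lia.
rewrite /walk_mem /init_mem size_table ij nth_mkseq //.
rewrite mulnC divnMDl // modnMDl divn_small // addn0.
by rewrite [j %% 8]modn_small // modn_small.
Qed.

Lemma walk_mem_word T S i : S < 2 ^ T ->
  walk_mem T S (8 * nb_records + i) = S %/ 2 ^ (i * w) %% 2 ^ w.
Proof.
move=> ST; rewrite /walk_mem /init_mem size_table ltnNge leq_addr /=.
by rewrite addKn packed_bits_of.
Qed.

(** * Correctness of the descent through the table *)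

Section Retrieve.

Variable Cm : nat.
Hypothesis Km_gt0 : 0 < Km.
Hypothesis split_le : #|{: walk_split V Lm}| <= Km.
Hypothesis B_ge : Kx * Kx <= 2 ^ B.
Hypothesis cost_le : forall x, cost x <= Cm.
Hypothesis L_ge : N * Cm <= L.
Hypothesis B_le : B < w.
Hypothesis Br_le : Br < w.
Hypothesis V_le : #|V| < 2 ^ w.
Hypothesis N_lt : N < 2 ^ w.
Hypothesis records_lt : 8 * nb_records < 2 ^ w.

Let w_gt0 : 0 < w.
Proof. exact: leq_ltn_trans B_le. Qed.

Lemma spill_Kx h m x y l : spill h m x y l <= Kx.
Proof. exact: spill_le. Qed.

Lemma slot_lt h m x y l : slot h m x y l < #|{: block}|.
Proof. exact: ltn_ord. Qed.

Lemma slot_record_lt h m x y l k :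
  k < Kx -> first_node + slot h m x y l * Kx + k < nb_records.
Proof.
move=> kK; rewrite /nb_records -addnA ltn_add2l.
have := slot_lt h m x y l; move: (slot _ _ _ _ _) (#|_|) => u v; nia.
Qed.

Lemma record_slot h m x y l k : h <= H -> m <= N -> l <= L -> k < Kx ->
  record (first_node + slot h m x y l * Kx + k) = node_record h m x y l k.
Proof.
move=> hH mN lL kK; rewrite /record -addnA.
have -> /= : (first_node + (slot h m x y l * Kx + k) == 0) = false by [].
rewrite ltnNge leq_addr /= addKn.
rewrite divnMDl ?(leq_ltn_trans _ kK) // modnMDl divn_small // addn0.
rewrite modn_small // (nth_map ((inord h, inord m, x, y, inord l) : block)).
  by rewrite /slot nth_enum_rank /= !inordK.
by rewrite -cardE slot_lt.
Qed.

Lemma walk_mem_node T S h m x y l k j :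
  h <= H -> m <= N -> l <= L -> k < Kx -> j < 8 ->
  nth 0 (node_record h m x y l k) j < 2 ^ w ->
  walk_mem T S (ptr h m x y l + 8 * k + j) = nth 0 (node_record h m x y l k) j.
Proof.
move=> hH mN lL kK j8; rewrite -record_slot // => lt.
by rewrite /ptr -mulnDr walk_mem_table // slot_record_lt.
Qed.

Definition walk_cost (x : V) (s : seq V) : nat := sumn (map cost (belast x s)).

Lemma walk_cost_le x s : walk_cost x s <= size s * Cm.
Proof.
elim: s x => //= y s IH x; rewrite /walk_cost /= mulSn leq_add //; exact: IH.
Qed.

Notation run k := (iter k (step w walk_program)).

(** The invariant allows any position [base] in any string [S], so that it applies to both halves
    wherever they are placed. A level costs at most 36 instructions and a leaf 5. *)
Definition stored (h m : nat) (v : seq V) (x y : V) (l E k : nat) : Prop :=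
  forall T S base q s, S < 2 ^ T -> base + bits h m x y l <= T ->
  8 * nb_records + T + 1 < 2 ^ w -> extract S base (bits h m x y l) = E ->
  q < m -> in_loop w (8 * nb_records) (walk_mem T S) s q
             (ptr h m x y l + 8 * k) base ->
  exists t, [/\ t <= 36 * h + 5, halted walk_program (run t s)
              & reg (run t s) 0 = enum_rank (nth x v q)].

Lemma ptr_record_lt h m x y l k j :
  k < Kx -> j < 8 -> ptr h m x y l + 8 * k + j < 2 ^ w.
Proof.
move=> kK j8; apply: leq_trans records_lt.
have := slot_record_lt h m x y l kK; rewrite /ptr; lia.
Qed.

Lemma stored_leaf h x : h <= H -> 1 <= N -> stored h 1 [:: x] x x 0 0 0.
Proof.
move=> hH N1 T S base q s ST bT Tw _ q1 s_loop.
have Kx0 : 0 < Kx by lia.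
have recE : node_record h 1 x x 0 0 = [:: val (enum_rank x); 0].
  by rewrite /node_record; case: (h).
have mem0 : walk_mem T S (ptr h 1 x x 0 + 8 * 0 + 0) = enum_rank x.
  by rewrite walk_mem_node ?recE //= (ltn_trans (ltn_ord _) V_le).
have mem1 : walk_mem T S (ptr h 1 x x 0 + 8 * 0 + 1) = 0.
  by rewrite walk_mem_node ?recE //= expn_gt0.
have [halt res] :=
  loop_leaf s_loop (ptr_record_lt _ _ _ _ _ Kx0 (isT : 1 < 8)) mem1.
exists 5; split; rewrite ?leq_addl // res; move: q1.
by rewrite -[X in walk_mem T S X]addn0 mem0; case: (q).
Qed.

Lemma retrieve h x s :
  h <= H -> size s < 2 ^ h -> size s < N -> path e x s ->
  exists E k, [/\ E < 2 ^ bits h (size s).+1 x (last x s) (walk_cost x s),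
    k < spill h (size s).+1 x (last x s) (walk_cost x s) &
    stored h (size s).+1 (x :: s) x (last x s) (walk_cost x s) E k].
Proof.
elim: h x s => [|h IH] x s hH s2h sN xs.
  case: s s2h sN {xs} => // _ sN; exists 0, 0; split=> //.
    by rewrite /spill /= !eqxx.
  exact: stored_leaf.
have [s0|s_gt0] := posnP (size s).
  rewrite (size0nil s0); exists 0, 0; split; rewrite ?expn_gt0 //.
    by rewrite /spill dims_leaf //= !eqxx.
  by apply: stored_leaf => //; lia.
move mE: (size s).+1 => m; have m1 : 1 < m by lia.
(* The left half also contains [x], hence the predecessor. *)
pose s1 := take (m./2).-1 s.
have s1_size : size s1 = (m./2).-1 by rewrite size_take; case: ifP; lia.
have [x2 [s2 sE]] : exists x2 s2, s = s1 ++ x2 :: s2.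
  case E: (drop (m./2).-1 s) => [|x2 s2].
    by have := size_drop (m./2).-1 s; rewrite E /=; lia.
  by exists x2, s2; rewrite -E cat_take_drop.
set y1 := last x s1.
have sizeE : size s = (size s1 + (size s2).+1)%N by rewrite {1}sE size_cat.
have m1E : (size s1).+1 = m./2 by lia.
have m2E : (size s2).+1 = m - m./2 by lia.
move: xs; rewrite {1}sE cat_path /= -/y1 => /and3P[xs1 e12 xs2].
have lastE : last x s = last x2 s2 by rewrite sE last_cat.
have costE : walk_cost x s = walk_cost x s1 + cost y1 + walk_cost x2 s2.
  by rewrite /walk_cost sE belast_cat map_cat sumn_cat /= addnA.
have l_le : walk_cost x s <= L.
  apply: leq_trans L_ge; apply: leq_trans (walk_cost_le _ _) _.
  by rewrite leq_mul2r ltnW ?orbT.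
have hH' : h <= H by apply: ltnW.
have m_le : m <= 2 * 2 ^ h by rewrite -expnS -mE.
have [||E1 [k1 [E1_lt k1_lt st1]]] := IH x s1 hH' _ _ xs1; [lia|lia|].
have [||E2 [k2 [E2_lt k2_lt st2]]] := IH x2 s2 hH' _ _ xs2; [lia|lia|].
have m_spl : x :: s = (x :: s1) ++ (x2 :: s2) by rewrite sE.
rewrite m_spl lastE; move: l_le costE.
rewrite -/y1 m1E in E1_lt k1_lt st1; rewrite m2E in E2_lt k2_lt st2.
have s1_sz : size (x :: s1) = m./2 by [].
have s2_sz : size (x2 :: s2) = m - m./2 by [].
move: (walk_cost x s) (walk_cost x s1) (walk_cost x2 s2) (last x2 s2)
  E1_lt k1_lt st1 E2_lt k2_lt st2 s1_sz s2_sz.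
move: (x :: s1) (x2 :: s2) => v1 v2 l l1 l2 y.
move=> E1_lt k1_lt st1 E2_lt k2_lt st2 v1_size v2_size lL lE.
pose c : walk_split V Lm := ((y1, x2), inord l1).
have c2E : val c.2 = l1 by rewrite /= inordK // ltnS; lia.
have rcE : rcost cost l c = l2 by rewrite /rcost c2E lE /= addKn.
have c_ok : ok_split e cost l c by rewrite /ok_split c2E /= e12 lE leq_addr.
pose M := node_bits h m x y l; pose K := node_spill h m x y l.
pose K2 := spill h (m - m./2) x2 y l2.
have McE : M c = bits h m./2 x y1 l1 + bits h (m - m./2) x2 y l2.
  by rewrite /M /node_bits /lbits /rbits rcE c2E.
have KcE : K c = spill h m./2 x y1 l1 * K2.
  by rewrite /K /node_spill c_ok /lspill /rspill rcE c2E.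
pose t := k1 * K2 + k2.
have t_lt : t < K c by rewrite KcE /t; nia.
have range := spill_rangeP e cost Km_gt0 split_le B_ge.
have K_le d : K d <= 2 ^ B by apply: node_spill_le => //; apply: range.
have M_gt0 d : 0 < M d -> 0 < K d -> Km <= K d.
  by apply: node_spill_ge; apply: range.
pose lo := low M K Km B c.
have bits_le : M c + lo <= bits h.+1 m x y l.
  rewrite bits_node // -/M -/K /lo /low.
  have Kc_gt0 := leq_ltn_trans (leq0n _) t_lt.
  rewrite -[leqRHS](subnKC (M_le_cmem Km_gt0 M_gt0 Kc_gt0)).
  by rewrite leq_add2l geq_minl.
have k_lt : spill_code M K Km B c t < spill h.+1 m x y l.
  by rewrite spill_node //; apply: spill_code_lt.
set k := spill_code M K Km B c t in k_lt *.
pose A1 := bits h m./2 x y1 l1; pose A2 := bits h (m - m./2) x2 y l2.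
(* Layout from the low end: the bits of the left half, those of the right half, then the low bits of
   [t], whose high part is in [k]. *)
exists (E1 + 2 ^ A1 * (E2 + 2 ^ A2 * (t %% 2 ^ lo))), k; split=> //.
  apply: leq_trans (_ : 2 ^ (A1 + (A2 + lo)) <= _); last first.
    by rewrite leq_exp2l // addnA -McE.
  rewrite !expnD.
  by rewrite !mixed_radix_lt // ltn_pmod ?expn_gt0.
move=> T S base q s' ST bT Tw SE qm s_loop.
set b := bits h.+1 m x y l in bits_le bT SE.
rewrite McE -/A1 -/A2 in bits_le.
have S1 : extract S base A1 = E1.
  rewrite -[base]addn0 (@extract_sub _ _ b) ?SE ?divn1; last lia.
  exact: mixed_radix_mod.
have S2 : extract S (base + A1) A2 = E2.
  rewrite (@extract_sub _ _ b) ?SE; last lia.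
  by rewrite mixed_radix_div ?mixed_radix_mod.
have S3 : extract S (base + (A1 + A2)) lo = t %% 2 ^ lo.
  rewrite (@extract_sub _ _ b) ?SE; last lia.
  by rewrite divn_exp2 !mixed_radix_div // modn_mod.
pose hi := t %/ 2 ^ lo.
have kKx : k < Kx.
  by apply: leq_trans k_lt _; apply: spill_le.
have recE : node_record h.+1 m x y l k = split_record h m x y l hi c.
  rewrite /node_record leqNgt m1 /= spill_codeKl // spill_codeKr //.
  by rewrite (nth_map c) ?nth_enum_rank // -cardE ltn_ord.
set addr := ptr _ _ _ _ _ + _ in s_loop.
have mN : m <= N by rewrite -mE.
have B_lt : 2 ^ B < 2 ^ w by rewrite ltn_exp2l.
have K2_lt : K2 < 2 ^ w.
  apply: leq_ltn_trans B_lt; apply: leq_trans B_ge.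
  by rewrite (leq_trans (spill_Kx _ _ _ _ _)) // leq_pmulr // muln_gt0.
have Kx0 : 0 < Kx by rewrite muln_gt0.
have rd j : j < 8 -> nth 0 (split_record h m x y l hi c) j < 2 ^ w ->
    walk_mem T S (addr + j) = nth 0 (split_record h m x y l hi c) j.
  by move=> j8 lt; rewrite walk_mem_node ?recE.
have lo_lt : 2 ^ lo < 2 ^ w.
  by apply: leq_ltn_trans B_lt; rewrite leq_exp2l // geq_minr.
have hi_le : hi * 2 ^ lo <= t by apply: leq_divM.
have t_ltw : t < 2 ^ w by apply: ltn_trans t_lt _; apply: leq_ltn_trans B_lt.
have ptr_lt h0 m0 x0 y0 l0 k0 : k0 < Kx -> ptr h0 m0 x0 y0 l0 + 8 * k0 < 2 ^ w.
  move=> k0K; have := ptr_record_lt h0 m0 x0 y0 l0 k0K (isT : 0 < 8).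
  by rewrite addn0.
have ptr_lt0 h0 m0 x0 y0 l0 : ptr h0 m0 x0 y0 l0 < 2 ^ w.
  by have := ptr_lt h0 m0 x0 y0 l0 _ Kx0; rewrite muln0 addn0.
have recP : record_at (walk_mem T S) addr (m./2) K2 (M c) lo (hi * 2 ^ lo)
    (ptr h m./2 x y1 l1) (ptr h (m - m./2) x2 y l2) A1.
  have A1E : lbits h m x c = A1 by rewrite /lbits c2E.
  have K2E : rspill h m y l c = K2 by rewrite /rspill rcE.
  split; [|by rewrite rd /= ?K2E|split|split].
  - by rewrite -[addr]addn0 rd //=; lia.
  - by rewrite rd //= -/M McE -/A1 -/A2; lia.
  - by rewrite rd.
  - by rewrite rd //=; apply: leq_ltn_trans t_ltw.
  - by rewrite rd //= c2E.
  - by rewrite rd //= rcE.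
  - by rewrite rd //= A1E; lia.
have tE : hi * 2 ^ lo + extract S (base + M c) lo = t.
  by rewrite McE S3 -divn_eq.
have K2_gt0 : 0 < K2 by apply: leq_ltn_trans k2_lt.
have addr_lt : addr + 7 < 2 ^ w by apply: ptr_record_lt.
have mem_w i := walk_mem_word i ST.
have pos_lt : 8 * nb_records + (base + M c) + 1 < 2 ^ w.
  by rewrite McE -/A1 -/A2; lia.
have t_div : t %/ K2 = k1 by rewrite /t divnMDl // divn_small ?addn0.
have t_mod : t %% K2 = k2 by rewrite /t modnMDl modn_small.
have t_lt' : hi * 2 ^ lo + extract S (base + M c) lo < 2 ^ w by rewrite tE.
have lo_le : lo <= w by rewrite (leq_trans (geq_minr _ _)) // ltnW.
have [qm1|mq1] := ltnP q m./2.
  have := loop_left w_gt0 mem_w s_loop recP lo_le K2_gt0 addr_lt pos_lt t_lt'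
    qm1.
  rewrite tE t_div => /(_ (ptr_lt _ _ _ _ _ _ _)) loop'.
  have [||u [u_le halt res]] := st1 T S base q _ ST _ Tw S1 qm1 (loop' _).
  - lia.
  - by apply: leq_trans k1_lt (spill_Kx _ _ _ _ _).
  exists (u + 34); rewrite iterD; split=> //; first lia.
  by rewrite res nth_cat v1_size qm1.
have q_lt : m./2 <= q < 2 ^ w by rewrite mq1 (leq_ltn_trans _ N_lt) //; lia.
have := loop_right w_gt0 mem_w s_loop recP lo_le K2_gt0 addr_lt pos_lt t_lt'
  q_lt.
rewrite tE t_mod => /(_ (ptr_lt _ _ _ _ _ _ _)) loop'.
have [||||u [u_le halt res]] :=
  st2 T S (base + A1) (q - m./2) _ ST _ Tw S2 _ (loop' _ _).
- lia.
- lia.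
- by apply: leq_trans k2_lt (spill_Kx _ _ _ _ _).
- lia.
exists (u + 36); rewrite iterD; split=> //; first lia.
rewrite res nth_cat v1_size ltnNge mq1 /= (set_nth_default x2) //.
by rewrite v2_size; lia.
Qed.

Hypothesis a_le : forall r, root_ok r -> a r <= Br.
Hypothesis code_lt : forall r, root_ok r -> code r < 2 ^ a r.
Hypothesis code_free : forall r r', root_ok r -> root_ok r' -> r != r' ->
  a r <= a r' -> code r' %% 2 ^ a r != code r.

(** The pick is unique: of two codewords that both begin [j], one would be a prefix of the other. *)
Lemma root_record_code j r : root_ok r -> j %% 2 ^ a r = code r ->
  root_record j = [:: 0; 1; 0; 2 ^ 0; 0; 0;
                      ptr H N r.1.1.1 r.1.1.2 r.1.2 + 8 * r.2; a r].
Proof.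
move=> r_ok jr; rewrite /root_record; case: pickP => [r'|/(_ r)]; last first.
  by rewrite r_ok jr eqxx.
case/andP=> r'_ok /eqP jr'; suff -> : r' = r by [].
apply/eqP/negPn/negP => rr'; have [le|/ltnW le] := leqP (a r) (a r').
  have := code_free r_ok r'_ok; rewrite eq_sym rr' -jr' => /(_ isT le).
  by rewrite modn_exp2_le // jr eqxx.
have := code_free r'_ok r_ok rr' le.
by rewrite -jr modn_exp2_le // jr' eqxx.
Qed.

Lemma store_walk x s : (size s).+1 = N -> N <= 2 ^ H -> path e x s ->
  exists r : root_state, let T := a r + bits H N x (last x s) (walk_cost x s) in
    [/\ root_ok r, r.1 = (x, last x s, inord (walk_cost x s)) :> V * V * 'I_Lm
      & 8 * nb_records + T + 1 < 2 ^ w -> exists2 S, S < 2 ^ T &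
        forall q, q < N ->
        answers w walk_program table (bits_of T S) (36 * H + 82) q
          (enum_rank (nth x (x :: s) q))].
Proof.
move=> sN NH xs.
have [||E [k [E_lt k_lt st]]] := retrieve (leqnn H) _ _ xs; [lia|lia|].
rewrite sN in E_lt k_lt st.
have l_le : walk_cost x s <= L.
  apply: leq_trans L_ge; apply: leq_trans (walk_cost_le _ _) _.
  by rewrite leq_mul2r -sN leqnSn orbT.
move: (walk_cost x s) (last x s) l_le E_lt k_lt st => l y lL E_lt k_lt st.
have kKx : k < Kx by apply: leq_trans k_lt (spill_Kx _ _ _ _ _).
have lE : val (inord l : 'I_Lm) = l by rewrite /= inordK.
exists (x, y, inord l, Ordinal kKx); set r : root_state := (_, _, _, _) => T.
have r_ok : root_ok r by rewrite /root_ok /= -[nat_of_ord _]/(val _) lE.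
split=> // Tw; pose S := code r + 2 ^ a r * E.
have ST : S < 2 ^ T by rewrite expnD mixed_radix_lt ?code_lt.
exists S => // q qN.
have S_mod : S %% 2 ^ a r = code r by rewrite mixed_radix_mod ?code_lt.
have S_div : extract S (a r) (bits H N x y l) = E.
  by rewrite /extract mixed_radix_div ?code_lt // modn_small.
(* [Br] bits are read whatever the length of the codeword; the low [a r] of them decide which root
   state is meant. *)
pose j := S %% 2 ^ Br.
have jr : j %% 2 ^ a r = code r by rewrite modn_exp2_le ?a_le.
have j_lt : j < 2 ^ Br by rewrite ltn_pmod ?expn_gt0.
have rec_j : record (2 + j) = root_record j.
  have j2 : 2 + j < first_node by rewrite ltn_add2l.
  by rewrite /record j2 addKn.
have Br_lt : 2 ^ Br < 2 ^ w by rewrite ltn_exp2l.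
have nb_gt : first_node <= nb_records by apply: leq_addr.
have w8 : 15 < 2 ^ w.
  by apply: leq_trans records_lt; rewrite /nb_records /first_node; lia.
have addr_lt : ptr H N x y l + 8 * k < 2 ^ w.
  by have := ptr_record_lt H N x y l kKx (isT : 0 < 8); rewrite addn0.
have mem_w i := walk_mem_word i ST.
have nb_gt1 : 1 < nb_records by apply: leq_trans nb_gt.
have rd i j' : i < nb_records -> j' < 8 -> nth 0 (record i) j' < 2 ^ w ->
    walk_mem T S (8 * i + j') = nth 0 (record i) j'.
  exact: walk_mem_table.
move memE: (walk_mem T S) mem_w rd => mem mem_w rd.
have m0 : mem 0 = w.
  have := rd 0 0 (ltnW nb_gt1) isT (ltn_expl w (isT : 1 < 2)).
  by rewrite muln0 addn0.
have m1 : mem 1 = 8 * nb_records.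
  by have := rd 0 1 (ltnW nb_gt1) isT records_lt; rewrite muln0 add0n.
have qw : q < 2 ^ w by apply: ltn_trans N_lt.
have s1 := loop_init q m0 m1 (leq_trans (isT : 8 < 16) w8).
have rec1 : record_at mem 8 0 (2 ^ Br) 0 Br 0 0 16 0.
  have {}rd j' := rd 1 j' nb_gt1.
  rewrite muln1 in rd.
  split; [rewrite -[8]addn0| |split|split].
  - by rewrite (rd 0 isT) ?expn_gt0.
  - by rewrite (rd 1 isT).
  - by rewrite (rd 2 isT) ?expn_gt0.
  - by rewrite (rd 3 isT).
  - by rewrite (rd 4 isT) ?expn_gt0.
  - by rewrite (rd 5 isT) ?expn_gt0.
  - by rewrite (rd 6 isT); rewrite //=; lia.
  - by rewrite (rd 7 isT) ?expn_gt0.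
have ext1 : 0 + extract S (0 + 0) Br = j by rewrite /extract expn0 divn1.
have nb_j : 2 + j < nb_records.
  by apply: leq_trans nb_gt; rewrite /first_node ltn_add2l.
have {s1 rec1}s2 : in_loop w (8 * nb_records) mem
    (run 36 (run 5 (State 0 (fun i => if i == 0 then q else 0) mem)))
    q (8 * (2 + j)) 0.
  have := loop_right w_gt0 mem_w s1 rec1 (ltnW Br_le).
  rewrite ext1 [j %% _]modn_small // subn0 mulnDr; apply=> //.
  - by rewrite expn_gt0.
  - by apply: leq_ltn_trans Tw; lia.
  - by apply: ltn_trans Br_lt.
  - by apply: ltn_trans records_lt; lia.
  - by rewrite expn_gt0.
have r_rec :
    record_at mem (8 * (2 + j)) 0 1 0 0 0 0 (ptr H N x y l + 8 * k) (a r).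
  have {}rd j' := rd (2 + j) j' nb_j.
  rewrite rec_j (root_record_code r_ok jr) in rd.
  split; [rewrite -[8 * _]addn0| |split|split].
  - by rewrite (rd 0 isT) ?expn_gt0.
  - by rewrite (rd 1 isT) //= (leq_trans _ w8).
  - by rewrite (rd 2 isT) ?expn_gt0.
  - by rewrite (rd 3 isT) //= (leq_trans _ w8).
  - by rewrite (rd 4 isT) ?expn_gt0.
  - by rewrite (rd 5 isT) ?expn_gt0.
  - by rewrite (rd 6 isT) //= -[nat_of_ord (inord l)]/(val _) lE.
  - by rewrite (rd 7 isT) //=; lia.
have s3 : in_loop w (8 * nb_records) mem (run 36 (run 36
    (run 5 (State 0 (fun i => if i == 0 then q else 0) mem))))
    q (ptr H N x y l + 8 * k) (a r).
  have := loop_right w_gt0 mem_w s2 r_rec (leq0n _).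
  rewrite modn1 muln0 !addn0 subn0 !add0n; apply=> //.
  - by apply: leq_trans records_lt; lia.
  - by apply: leq_ltn_trans Tw; lia.
  - by rewrite /extract expn0 modn1 expn_gt0.
  - by lia.
rewrite -memE in s3.
have [u [u_le halt res]] := st T S (a r) q _ ST (leqnn _) Tw S_div qN s3.
rewrite /answers /init_state [q %% _]modn_small //.
(* 82 = 5 + 36 + 36 + 5: initialization, starting record, root record and leaf. *)
have -> : 36 * H + 82 = 36 * H + 5 - u + (u + (36 + (36 + 5))) by lia.
rewrite !iterD -/(walk_mem T S); move: (run u _) halt res => sf halt res.
by rewrite (halted_iter _ _ halt).
Qed.

End Retrieve.

End Table.

(** * The code of the root *)

Section RootCode.

Variables (R : realType) (b : R) (V : finType) (e : rel V) (cost : V -> nat).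
Variables (L Km B N H Br c : nat).

Notation Lm := L.+1.
Notation bits := (bits e cost Lm Km B).
Notation spill := (spill e cost Lm Km B).
Notation root_state := (root_state V L Km).
Notation root_ok := (@root_ok V e cost L Km B N H).

Hypothesis N_gt0 : 0 < N.
Hypothesis Km_gt0 : 0 < Km.
Hypothesis Km_ge : 2 * N * #|{: walk_split V Lm}| <= Km.
Hypothesis B_ge : 3 * Km * (3 * Km) <= 2 ^ B.
Hypothesis Br_ge : 2 * #|{: root_state}| <= 2 ^ Br.
Hypothesis c_ge : 4 * #|V| <= 2 ^ c.
Hypothesis c_gt0 : 0 < c.
Hypothesis b_ge0 : (0 <= b)%R.
Hypothesis b_expN : (b ^+ N = 2^-1)%R.
Hypothesis b_cost : forall x, (b ^+ cost x * (outdeg e x)%:R <= 1)%R.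

Let split_le : #|{: walk_split V Lm}| <= Km.
Proof. by apply: leq_trans Km_ge; rewrite leq_pmull // muln_gt0. Qed.

Local Open Scope ring_scope.

(** By [Km_ge], [loss] is [1 + s] with [N * s] at most one half, and [(1 + s) ^+ N <= expR (N * s)
    <= expR 2^-1 <= 2]. *)
Lemma loss_exp_le k : (k <= N)%N -> loss V Lm Km R ^+ k <= 2.
Proof.
move=> kN; set s := (#|{: walk_split V Lm}|%:R / Km%:R : R).
have Km0 : 0 < Km%:R :> R by rewrite ltr0n.
have lossE : loss V Lm Km R = 1 + s.
  by rewrite /loss natrD mulrDl divff ?gt_eqF.
have s_ge0 : 0 <= s by rewrite divr_ge0.
have s_le : N%:R * s <= 2^-1.
  rewrite mulrA ler_pdivrMr // [2^-1 * _]mulrC ler_pdivlMr // -!natrM ler_nat.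
  by rewrite mulnC mulnA.
apply: le_trans (_ : expR (N%:R * s) <= _).
  rewrite lossE expRM_natl; apply: le_trans (_ : (1 + s) ^+ N <= _).
    by rewrite ler_weXn2l // lerDl.
  by rewrite lerXn2r ?nnegrE ?expR_ge0 ?expR_ge1Dx // addr_ge0.
apply: le_trans (_ : expR 2^-1 <= _); first by rewrite ler_expR.
rewrite -[leLHS]invrK -expRN -[leRHS]invrK.
rewrite lef_pV2 ?posrE ?expR_gt0 ?invr_gt0 //.
by apply: le_trans (expR_ge1Dx _); lra.
Qed.

Lemma b_expl l : 2^-1 ^+ (l %/ N).+1 <= b ^+ l.
Proof.
have b1 : b <= 1.
  by rewrite -(expr_le1 N_gt0) // b_expN; lra.
rewrite -b_expN -exprM; apply: ler_wiXn2l => //.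
by rewrite mulnS addnC mulnC {1}(divn_eq l N) leq_add2l ltnW // ltn_pmod.
Qed.

Lemma weight_le2 x : weight e cost Lm Km B b H N x <= 2.
Proof.
apply: le_trans (weight_le _ _ _ _ _ _ _ _) _ => //.
by apply: loss_exp_le; apply: leq_pred.
Qed.

(** About the negative logarithm of [b ^+ l * 2 ^+ bits / 2 ^+ c], so that codeword and memory
    together take about [l / N + c] bits. The cap [Br] bounds the number of root records. *)
Definition root_len (r : root_state) : nat :=
  minn Br ((r.1.2 %/ N).+1 + c - bits H N r.1.1.1 r.1.1.2 r.1.2).

(** The capacity of an attainable label enters [weight], so [b ^+ l * 2 ^+ bits <= 2]. Hence the
    subtraction in [root_len] does not truncate. *)
Lemma bits_le_cost r : root_ok r ->
  (bits H N r.1.1.1 r.1.1.2 r.1.2 <= (r.1.2 %/ N).+1 + c)%N.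
Proof.
case: r => [[[x y] l] k]; rewrite /root_ok /= => k_lt.
have cap : b ^+ l * (capacity e cost Lm Km B H N x y l)%:R <= 2.
  apply: le_trans (weight_le2 x); rewrite /weight (bigD1 y) //= (bigD1 l) //=.
  rewrite -addrA lerDl addr_ge0 // sumr_ge0 // => i _; last first.
    apply: sumr_ge0 => j _.
    by rewrite mulr_ge0 ?exprn_ge0.
  by rewrite mulr_ge0 ?exprn_ge0.
have : (2 ^ bits H N x y l <= 2 ^ ((l %/ N).+1 + 1))%N.
  rewrite -(ler_nat R) !natrX addn1 exprS.
  have p0 : 0 < (2 : R) ^+ (l %/ N).+1 by rewrite exprn_gt0.
  rewrite -ler_pdivrMr // -exprVn mulrC; apply: le_trans cap.
  apply: ler_pM; rewrite ?exprn_ge0 ?b_expl // ?invr_ge0 //.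
  by rewrite -natrX ler_nat leq_pmulr // (leq_ltn_trans _ k_lt).
rewrite leq_exp2l // => /leq_trans; apply; by rewrite leq_add2l.
Qed.

Lemma root_len_term r :
  (2 ^ (Br - root_len r))%:R <=
  1 + 2 ^+ Br / 2 ^+ c * (b ^+ r.1.2 *
        2 ^+ bits H N r.1.1.1 r.1.1.2 r.1.2) :> R.
Proof.
rewrite /root_len; set M := bits _ _ _ _ _; set u := (_ %/ _).+1.
have nn : 0 <= 2 ^+ Br / 2 ^+ c * (b ^+ r.1.2 * 2 ^+ M).
  by rewrite !mulr_ge0 ?invr_ge0 ?exprn_ge0.
have [le|lt] := leqP Br (u + c - M); first by rewrite subnn lerDl.
apply: le_trans (_ : 2 ^+ Br / 2 ^+ c * (b ^+ r.1.2 * 2 ^+ M) <= _); last first.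
  by rewrite lerDr.
apply: le_trans (_ : 2 ^+ Br / 2 ^+ c * (2^-1 ^+ u * 2 ^+ M) <= _); last first.
  by rewrite ler_wpM2l ?divr_ge0 ?exprn_ge0 // ler_wpM2r ?exprn_ge0 ?b_expl.
rewrite exprVn natrX.
have -> : 2 ^+ Br / 2 ^+ c * (2 ^- u * 2 ^+ M) =
    2 ^+ Br * 2 ^+ M / 2 ^+ (u + c) :> R.
  rewrite exprD invfM.
  by move: (2 ^+ Br) (2 ^+ M) (2 ^- u) (2 ^- c) => p q r' s; ring.
rewrite ler_pdivlMr ?exprn_gt0 // -!exprD ler_weXn2l ?ler1n //; lia.
Qed.

(** Each of the two parts of [root_len_term] gets half of the Kraft budget: the ones count root
    states, controlled by [Br_ge], and the rest adds up to weights, controlled by [c_ge]. *)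
Lemma root_len_kraft :
  (\sum_(r | root_ok r) 2 ^ (Br - root_len r) <= 2 ^ Br)%N.
Proof.
rewrite -(ler_nat R) natr_sum natrX.
pose g (x y : V) (l : nat) : R := b ^+ l * 2 ^+ bits H N x y l.
apply: le_trans (_ : \sum_(r | root_ok r)
   (1 + 2 ^+ Br / 2 ^+ c * g r.1.1.1 r.1.1.2 r.1.2) <= _).
  by apply: ler_sum => r _; apply: root_len_term.
rewrite big_split /= -mulr_sumr.
(* Summing over the admissible spills turns [2 ^+ bits] into the capacity of the label. *)
have -> : \sum_(r | root_ok r) g r.1.1.1 r.1.1.2 r.1.2 =
          \sum_x weight e cost Lm Km B b H N x.
  rewrite big_mkcond /=.
  rewrite -(pair_bigA _ (fun (p : V * V * 'I_Lm) (k : 'I_(3 * Km)) =>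
    if root_ok (p, k) then g p.1.1 p.1.2 p.2 else 0)) /=.
  rewrite -(pair_bigA _ (fun (p : V * V) (l : 'I_Lm) => \sum_(k < 3 * Km)
    if root_ok (p, l, k) then g p.1 p.2 l else 0)) /=.
  rewrite -(pair_bigA _ (fun x y => \sum_(l < Lm) \sum_(k < 3 * Km)
    if root_ok (x, y, l, k) then g x y l else 0)) /=.
  apply: eq_bigr => x _; apply: eq_bigr => y _; apply: eq_bigr => l _.
  rewrite -big_mkcond sumr_const /capacity natrM natrX mulrA -/(g x y l).
  rewrite -[LHS]mulr_natr; congr (_ * _%:R).
  rewrite -sum1_card /root_ok /=.
  have le : (spill H N x y l <= 3 * Km)%N by apply: spill_le.
  rewrite (eq_bigl (fun k : 'I_(3 * Km) => (k < spill H N x y l)%N)) //.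
  by rewrite -(big_ord_widen _ (fun=> 1%N) le) sum1_card card_ord.
have s1 : \sum_(r | root_ok r) (1 : R) <= 2 ^+ Br / 2.
  rewrite sumr_const ler_pdivlMr // -[X in _ *+ _ * X]/(2%:R).
  rewrite -natrM -natrX ler_nat.
  by apply: leq_trans Br_ge; rewrite mulnC leq_mul2l max_card orbT.
have s2 : \sum_x weight e cost Lm Km B b H N x <= 2 * #|V|%:R.
  apply: le_trans (ler_sum _ (fun x _ => weight_le2 x)) _.
  by rewrite sumr_const -[leLHS]mulr_natr.
have c0 : 0 < 2 ^+ c :> R by rewrite exprn_gt0.
have s3 : 2 ^+ Br / 2 ^+ c * \sum_x weight e cost Lm Km B b H N x <=
    2 ^+ Br / 2.
  rewrite -mulrA ler_pM2l ?exprn_gt0 // mulrC ler_pdivrMr //.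
  apply: le_trans s2 _; move: c_ge; rewrite -(ler_nat R) natrX natrM; lra.
apply: le_trans (lerD s1 s3) _; lra.
Qed.

Lemma root_code : exists a code : root_state -> nat, forall r, root_ok r ->
  [/\ (a r <= Br)%N,
      (a r + bits H N r.1.1.1 r.1.1.2 r.1.2 <= (r.1.2 %/ N).+1 + c)%N,
      (code r < 2 ^ a r)%N &
      forall r', root_ok r' -> r != r' -> (a r <= a r')%N ->
        (code r' %% 2 ^ a r != code r)%N].
Proof.
have len_le r : root_ok r -> (root_len r <= Br)%N by rewrite geq_minl.
have [code [code_lt code_free]] := kraft len_le root_len_kraft.
exists root_len, code => r r_ok; split=> [|||r' r'_ok].
- exact: len_le.
- apply: leq_trans (leq_add (geq_minr _ _) (leqnn _)) _.
  by rewrite subnK // bits_le_cost.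
- exact: code_lt.
- exact: code_free.
Qed.

End RootCode.

(** * Logarithms and sizes *)

Lemma exp_up_log_le m M : m <= M -> 0 < M -> 2 ^ up_log 2 m <= 2 * M.
Proof.
move=> mM M0; have [m1|m1] := leqP m 1.
  have -> : up_log 2 m = 0 by apply/eqP; rewrite up_log_eq0 m1.
  by rewrite expn0; lia.
have := up_log_gtn (isT : 1 < 2) m1.
have : 0 < up_log 2 m by rewrite up_log_gt0 m1.
by case: (up_log 2 m) => //= k _; rewrite expnS; lia.
Qed.

Lemma walk_cost_sum (V : finType) (cost : V -> nat) x s :
  walk_cost cost x s = \sum_(i < size s) cost (nth x (x :: s) i).
Proof.
elim: s x => [|y s IH] x; first by rewrite big_ord0.
rewrite /walk_cost /= -/(walk_cost cost y s) IH big_ord_recl /=; congr (_ + _).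
apply: eq_bigr => i _; congr cost; apply: set_nth_default.
by rewrite /= ltnS ltnW.
Qed.

Section Logarithms.

Variable R : realType.
Local Open Scope ring_scope.

Lemma half_root N : (0 < N)%N -> exists2 b : R, 0 <= b & b ^+ N = 2^-1.
Proof.
move=> N0; exists (expR (- ln 2 / N%:R)); first exact: expR_ge0.
rewrite -expRM_natl mulrC divfK ?pnatr_eq0 -?lt0n // expRN lnK //.
by rewrite posrE.
Qed.

(** The exponent is [N * lg d] rounded up and [b] is the [N]-th root of one half; comparing [N]-th
    powers avoids real logarithms. *)
Lemma half_root_up_log (b : R) N d : (0 < N)%N -> 0 <= b -> b ^+ N = 2^-1 ->
  b ^+ up_log 2 (d ^ N) * d%:R <= 1.
Proof.
move=> N0 b0 bN; rewrite -(expr_le1 N0) ?mulr_ge0 ?exprn_ge0 //.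
rewrite exprMn -exprM mulnC exprM bN exprVn mulrC ler_pdivrMr ?exprn_gt0 //.
by rewrite mul1r -!natrX ler_nat up_logP.
Qed.

Lemma up_log_le_log2 N d : (0 < d)%N ->
  (up_log 2 (d ^ N))%:R <= N%:R * log2 d%:R + 1 :> R.
Proof.
move=> d0; have d1 : 1 <= d%:R :> R by rewrite ler1n.
have ln2 : 0 < ln 2 :> R by rewrite ln_gt0 ?ltr1n.
have log0 : 0 <= log2 d%:R :> R by rewrite divr_ge0 ?(ltW ln2) // ln_ge0.
have [k0|k0] := posnP (up_log 2 (d ^ N)).
  by rewrite k0 addr_ge0 // mulr_ge0.
have k1 : (1 < d ^ N)%N by move: k0; rewrite up_log_gt0.
have := up_log_gtn (isT : (1 < 2)%N) k1.
rewrite -(prednK k0) /=; move: (_.-1) => k lt.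
rewrite -natr1 lerD2r /log2 mulrA ler_pdivlMr //.
rewrite !mulr_natl -!lnXn ?ltr0n // ler_ln ?posrE ?exprn_gt0 ?ltr0n //.
by rewrite -!natrX ler_nat ltnW.
Qed.

End Logarithms.

Lemma leq_exp_bitlen n : n < 2 ^ bitlen n.
Proof. exact: trunc_log_ltn. Qed.

(** * Choice of parameters and polynomial bounds *)

Section Sizes.

Variables v n w : nat.

Notation N := n.+1.
Notation H := (bitlen n).

Definition poly_size : nat := v.+1 ^ 6 * N ^ 6.
Definition max_cost : nat := N * (N * v).
Definition nb_splits : nat := v * v * max_cost.+1.
(** The factor [2 * N] keeps the accumulated loss over the tree at most 2; the successor keeps the
    unit positive on an empty graph. *)
Definition spill_unit : nat := 2 * N * nb_splits.+1.
Definition carry_bits : nat := up_log 2 (3 * spill_unit * (3 * spill_unit)).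
Definition root_bits : nat := up_log 2 (2 * (nb_splits * (3 * spill_unit))).
Definition table_records : nat :=
  2 + 2 ^ root_bits +
  H.+1 * N.+1 * v * v * max_cost.+1 * (3 * spill_unit).

Notation L := max_cost.
Notation S := nb_splits.
Notation Km := spill_unit.
Notation B := carry_bits.
Notation Br := root_bits.
Notation nb := table_records.
Notation X := poly_size.

Lemma X_gt0 : 0 < X.
Proof. by rewrite /X muln_gt0 !expn_gt0. Qed.

Lemma S_lt : S < v.+1 ^ 3 * N ^ 2.
Proof.
rewrite /S /L; move: (N) (ltn0Sn n) => M M0.
have -> : v * v * (M * (M * v)).+1 = v ^ 3 * M ^ 2 + v ^ 2.
  by rewrite -addn1; ring.
have -> : v.+1 ^ 3 * M ^ 2 = v ^ 3 * M ^ 2 + (3 * v ^ 2 + 3 * v + 1) * M ^ 2.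
  by rewrite -[v.+1]addn1; ring.
have M2 : 0 < M ^ 2 by rewrite expn_gt0 M0.
have := leq_pmulr (3 * v ^ 2 + 3 * v + 1) M2; lia.
Qed.

Lemma Km_le : Km <= 2 * (v.+1 ^ 3 * N ^ 3).
Proof.
rewrite /Km -mulnA leq_mul2l /= [N ^ 3]expnS mulnCA leq_mul2l S_lt orbT //.
Qed.

Lemma exp_B_le : 2 ^ B <= 72 * X.
Proof.
have le : 3 * Km * (3 * Km) <= 36 * X.
  have -> : 36 * X =
      3 * (2 * (v.+1 ^ 3 * N ^ 3)) * (3 * (2 * (v.+1 ^ 3 * N ^ 3))).
    by rewrite /X; ring.
  by rewrite leq_mul // leq_mul2l Km_le.
have X0 : 0 < 36 * X by rewrite muln_gt0 X_gt0.
by apply: leq_trans (exp_up_log_le le X0) _; rewrite mulnA.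
Qed.

Lemma SK_le : S * (3 * Km) <= 6 * (v.+1 ^ 6 * N ^ 5).
Proof.
have -> : 6 * (v.+1 ^ 6 * N ^ 5) =
    v.+1 ^ 3 * N ^ 2 * (3 * (2 * (v.+1 ^ 3 * N ^ 3))) by ring.
by rewrite leq_mul ?(ltnW S_lt) // leq_mul2l Km_le.
Qed.

Lemma X_ge : v.+1 ^ 6 * N ^ 5 <= X.
Proof. by rewrite /X leq_mul2l leq_pexp2l ?orbT. Qed.

Lemma exp_Br_le : 2 ^ Br <= 24 * X.
Proof.
have le : 2 * (S * (3 * Km)) <= 12 * X.
  by rewrite -[12]/(2 * 6) -mulnA leq_mul2l (leq_trans SK_le) // leq_mul2l X_ge.
have X0 : 0 < 12 * X by rewrite muln_gt0 X_gt0.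
by apply: leq_trans (exp_up_log_le le X0) _; rewrite mulnA.
Qed.

(** Node records dominate: heights give [H], lengths [N], costs [N ^ 2] and spills [N ^ 3]. *)
Lemma nb_le : 8 * nb <= 400 * H * X.
Proof.
have X0 := X_gt0.
have blk : H.+1 * N.+1 * v * v * L.+1 * (3 * Km) <= 24 * H * X.
  have -> : H.+1 * N.+1 * v * v * L.+1 * (3 * Km) =
      H.+1 * N.+1 * (S * (3 * Km)).
    by rewrite /S; ring.
  apply: leq_trans (_ : (2 * H) * (2 * N) * (6 * (v.+1 ^ 6 * N ^ 5)) <= _).
    by rewrite leq_mul ?SK_le // leq_mul //; rewrite /bitlen; lia.
  by rewrite /X (expnS N 5) leq_eqVlt; apply/orP; left; apply/eqP; ring.
have HX : X <= H * X by rewrite leq_pmull.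
by have := exp_Br_le; rewrite /nb; move: blk; rewrite -!mulnA; lia.
Qed.

Lemma memory_le : 0 < n -> 8 * nb + ((N * v).+1 + (v + 2)) + 1 < 512 * H * X.
Proof.
move=> n0; have X0 := X_gt0.
have HX : X <= H * X by rewrite leq_pmull.
have le_exp6 k : 0 < k -> k <= k ^ 6.
  by move=> k0; rewrite -{1}[k]expn1 leq_pexp2l.
have vX : v.+1 * N <= X by rewrite /X leq_mul ?le_exp6.
have : (N * v).+1 + (v + 2) + 1 <= 5 * (v.+1 * N) by nia.
by have := nb_le; rewrite -!mulnA; lia.
Qed.

Hypothesis w_ge : (16 + 6 * v) * H <= w.
Hypothesis n_gt0 : 0 < n.

(** The four factors have exponents at most 9, [H], [6 * v] and [6 * H], and [H] is positive; hence
    the constant [16 + 6 * v]. *)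
Lemma HX_le : 512 * H * X <= 2 ^ w.
Proof.
apply: leq_trans (_ : 2 ^ ((16 + 6 * v) * H) <= _); last by rewrite leq_exp2l.
have H0 : 0 < H by [].
apply: leq_trans (_ : 2 ^ (9 + H + (v * 6 + H * 6)) <= _); last first.
  by rewrite leq_exp2l //; nia.
have le1 : 512 <= 2 ^ 9 by [].
have le2 : H <= 2 ^ H := ltnW (ltn_expl _ (isT : 1 < 2)).
have le3 : v.+1 ^ 6 <= 2 ^ (v * 6) by rewrite expnM leq_exp2r // ltn_expl.
have le4 : N ^ 6 <= 2 ^ (H * 6) by rewrite expnM leq_exp2r // leq_exp_bitlen.
rewrite /X 2!expnD [2 ^ (_ + _ * 6)]expnD.
exact: leq_mul (leq_mul le1 le2) (leq_mul le3 le4).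
Qed.

Lemma B_lt_w : B < w.
Proof.
rewrite -(ltn_exp2l _ _ (isT : 1 < 2)); apply: leq_ltn_trans exp_B_le _.
apply: leq_trans HX_le; rewrite ltn_mul2r X_gt0 /=; rewrite /bitlen; lia.
Qed.

Lemma Br_lt_w : Br < w.
Proof.
rewrite -(ltn_exp2l _ _ (isT : 1 < 2)); apply: leq_ltn_trans exp_Br_le _.
apply: leq_trans HX_le; rewrite ltn_mul2r X_gt0 /=; rewrite /bitlen; lia.
Qed.

Lemma memory_lt_w : 8 * nb + ((N * v).+1 + (v + 2)) + 1 < 2 ^ w.
Proof. by apply: leq_trans (memory_le n_gt0) HX_le. Qed.

End Sizes.

(** * Assembly *)

Section Assembly.

Variables (R : realType) (V : finType) (e : rel V) (n w : nat).
Hypothesis n_gt0 : 0 < n.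
Hypothesis w_ge : (16 + 6 * #|V|) * bitlen n <= w.

Notation N := n.+1.
Notation L := (max_cost #|V| n).
Notation Km := (spill_unit #|V| n).
Notation B := (carry_bits #|V| n).
Notation Br := (root_bits #|V| n).

Definition vertex_cost (x : V) : nat := up_log 2 (outdeg e x ^ N).

Lemma vertex_cost_le x : vertex_cost x <= N * #|V|.
Proof.
apply: up_log_min => //; rewrite mulnC expnM leq_exp2r //.
by apply: leq_trans (max_card _) (ltnW (ltn_expl _ _)).
Qed.

Lemma card_walk_split : #|{: walk_split V L.+1}| = nb_splits #|V| n.
Proof. by rewrite !card_prod card_ord. Qed.

Lemma card_root_state :
  #|{: root_state V L Km}| = nb_splits #|V| n * (3 * Km).
Proof. by rewrite !card_prod !card_ord. Qed.

Lemma nb_recordsE :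
  nb_records V L Km N (bitlen n) Br = table_records #|V| n.
Proof. by rewrite /nb_records /first_node !card_prod !card_ord. Qed.

(** Each of the [n] charged costs is rounded up by at most 1 in units of [1 / N], less than one bit
    in total. Out-degrees are positive because the walk continues. *)
Lemma cost_quotient_le (x : V) (s : seq V) : size s = n -> path e x s ->
  ((walk_cost vertex_cost x s %/ N)%:R <=
   \sum_(i < n) log2 (outdeg e (nth x (x :: s) i))%:R + 1 :> R)%R.
Proof.
move=> sn xs; set l := walk_cost _ _ _.
have N0 : (0 < N%:R :> R)%R by rewrite ltr0n.
apply: (@le_trans _ _ (l%:R / N%:R)%R).
  by rewrite ler_pdivlMr // -natrM ler_nat leq_divM.
rewrite ler_pdivrMr // /l walk_cost_sum sn natr_sum.
apply: (@le_trans _ _ (\sum_(i < n)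
    (N%:R * log2 (outdeg e (nth x (x :: s) i))%:R + 1))%R).
  apply: ler_sum => i _; apply: up_log_le_log2; apply/card_gt0P.
  exists (nth x s i); rewrite inE; apply: (pathP x xs); by rewrite sn.
rewrite big_split /= -mulr_sumr sumr_const card_ord mulrDl mul1r mulrC lerD2l.
by rewrite ler_nat.
Qed.

Lemma answers_mono P T s t t' q out :
  t <= t' -> answers w P T s t q out -> answers w P T s t' q out.
Proof.
move=> tt' [halt res]; rewrite /answers -(subnK tt') iterD.
by rewrite (halted_iter _ _ halt).
Qed.

Lemma walk_structure : exists T (enc : N.-tuple V -> bitseq),
  [/\ all (fun x => x < 2 ^ w) T, size T = 8 * table_records #|V| n
    & stores_walks R e w walk_program T enc (#|V| + 4) (118 * bitlen n)].
Proof.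
have [b b_ge0 bN] := half_root R (ltn0Sn n).
have b_cost x := half_root_up_log (outdeg e x) (ltn0Sn n) b_ge0 bN.
have Km_gt0 : 0 < Km by rewrite !muln_gt0.
have Km_ge : 2 * N * #|{: walk_split V L.+1}| <= Km.
  by rewrite card_walk_split leq_mul2l leqnSn orbT.
have split_le : #|{: walk_split V L.+1}| <= Km.
  by apply: leq_trans Km_ge; rewrite leq_pmull.
have B_ge : 3 * Km * (3 * Km) <= 2 ^ B by apply: up_logP.
have Br_ge : 2 * #|{: root_state V L Km}| <= 2 ^ Br.
  by rewrite card_root_state; apply: up_logP.
have c_ge : 4 * #|V| <= 2 ^ (#|V| + 2).
  by rewrite addnC expnD leq_mul2l ltnW ?orbT // ltn_expl.
have c_gt0 : 0 < #|V| + 2 by rewrite addn2.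
have [a [code aP]] := root_code (cost := vertex_cost) (bitlen n) (ltn0Sn n)
  Km_gt0 Km_ge B_ge Br_ge c_ge c_gt0 b_ge0 bN b_cost.
pose T := table e vertex_cost B N (bitlen n) w Br a code.
have mem_lt := memory_lt_w w_ge n_gt0.
(* The table is fixed first; each walk then gets its own string, and [fin_all_exists] collects these
   into [enc]. *)
have enc_ex (v : N.-tuple V) : exists s : bitseq, sorted e v ->
    ((size s)%:R <= log2 (#|V|%:R : R)
       + \sum_(i < n)
           log2 ((outdeg e (tnth v (widen_ord (leqnSn n) i)))%:R : R)
       + (#|V| + 4)%:R)%R
    /\ forall q : 'I_N,
         answers w walk_program T s (118 * bitlen n) q (enum_rank (tnth v q)).
  case/tupleP: v => x s.
  have [xs|nxs] := boolP (path e x s); last first.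
    by exists [::] => xs; case/negP: nxs; apply: xs.
  have [r [r_ok rE rP]] : exists r : root_state V L Km,
      let l := walk_cost vertex_cost x s in
      let T' :=
        a r + bits e vertex_cost L.+1 Km B (bitlen n) N x (last x s) l in
      [/\ root_ok e vertex_cost B N (bitlen n) r,
          r.1 = (x, last x s, inord l)
        & 8 * nb_records V L Km N (bitlen n) Br + T' + 1 < 2 ^ w ->
          exists2 S, S < 2 ^ T' & forall q, q < N ->
          answers w walk_program T (bits_of T' S) (36 * bitlen n + 82) q
            (enum_rank (nth x (x :: s) q))].
    apply: (store_walk Km_gt0 split_le B_ge vertex_cost_le) xs => //.
    - exact: B_lt_w.
    - exact: Br_lt_w.
    - by apply: ltn_trans mem_lt; lia.
    - apply: leq_ltn_trans (leq_exp_bitlen n) _; rewrite ltn_exp2l //.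
      by apply: leq_trans w_ge; rewrite mulnDl; rewrite /bitlen; lia.
    - by rewrite nb_recordsE; apply: leq_ltn_trans mem_lt; lia.
    - by move=> r /aP[].
    - by move=> r /aP[].
    - by move=> r r' /aP[_ _ _ free] /free; apply.
    - by rewrite size_tuple.
    - exact: leq_exp_bitlen.
  have [_ size_le _ _] := aP r r_ok.
  have l_le : walk_cost vertex_cost x s <= L.
    apply: leq_trans (walk_cost_le vertex_cost_le _ _) _.
    by rewrite size_tuple leq_mul2r leqnSn orbT.
  move: size_le; rewrite rE /= inordK // => size_le.
  have quot_le := cost_quotient_le (size_tuple s) xs.
  have [|S S_lt ans] := rP.
    rewrite nb_recordsE; apply: leq_ltn_trans mem_lt.
    rewrite leq_add2r leq_add2l (leq_trans size_le) // leq_add2r ltnS.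
    by apply: leq_trans (leq_div2r N l_le) _; rewrite mulKn.
  exists (bits_of (a r + bits e vertex_cost L.+1 Km B (bitlen n) N x (last x s)
                   (walk_cost vertex_cost x s)) S) => _; split; last first.
    move=> q; rewrite (tnth_nth x); apply: answers_mono (ans q (ltn_ord q)).
    by rewrite /bitlen; lia.
  rewrite size_mkseq.
  under eq_bigr => i _ do rewrite (tnth_nth x).
  apply: le_trans
    (_ : ((walk_cost vertex_cost x s %/ N).+1 + (#|V| + 2))%:R <= _)%R.
    by rewrite ler_nat.
  have logV : (0 <= log2 (#|V|%:R : R))%R.
    rewrite divr_ge0 ?ln_ge0 ?ler1n // -?cardE; apply/card_gt0P; by exists x.
  (* The redundancy is [#|V| + 2] from the root code, 1 from rounding [l / N] up and 1 from rounding
     the costs. *)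
  rewrite -addn1 !natrD; move: quot_le logV => /=; lra.
have [enc encP] := fin_all_exists enc_ex.
exists T, enc; split; first exact: table_lt.
  by rewrite size_table nb_recordsE.
by move=> v ev; apply: encP.
Qed.

End Assembly.

Theorem theorem1p2 (R : realType) (V : finType) (e : rel V) :
  exists c0 : nat, forall c1 : nat,
  exists (P : program) (extra ct cT k : nat),
  forall n w : nat, 0 < n -> c0 * bitlen n <= w <= c1 * bitlen n ->
  exists (T : seq nat) (enc : n.+1.-tuple V -> bitseq),
    [/\ all (fun x => x < 2 ^ w) T,
        size T * w <= cT * n ^ 6 * bitlen n ^ k
      & stores_walks R e w P T enc extra (ct * bitlen n)].
Proof.
exists (16 + 6 * #|V|) => c1.
(* 118 = 36 + 82 as [bitlen n] is positive; 64 comes from [n.+1 <= 2 * n]; one factor [bitlen n]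
   counts tree heights and the other is the word size. *)
exists walk_program, (#|V| + 4), 118, (400 * 64 * #|V|.+1 ^ 6 * c1), 2.
move=> n w n_gt0 /andP[w_ge w_le].
have [T [enc [T_lt T_size stores]]] := walk_structure R e n_gt0 w_ge.
exists T, enc; split=> //; rewrite T_size.
apply: leq_trans (leq_mul (nb_le #|V| n) w_le) _.
have N_le : n.+1 ^ 6 <= 64 * n ^ 6.
  by rewrite -[64]/(2 ^ 6) -expnMn leq_exp2r //; lia.
rewrite /poly_size; move: (#|V|.+1 ^ 6) (n.+1 ^ 6) (n ^ 6) N_le => p a b ab.
have -> : 400 * bitlen n * (p * a) * (c1 * bitlen n) =
          400 * (p * c1 * bitlen n ^ 2) * a by ring.
have -> : 400 * 64 * p * c1 * b * bitlen n ^ 2 =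
          400 * (p * c1 * bitlen n ^ 2) * (64 * b) by ring.
by rewrite leq_mul2l ab orbT.
Qed.
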